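(* If a cardinal $\kappa$ is $\Pi^1_\xi$-indescribable where $\xi<\kappa^+$, then the collection \[\Pi^1_\xi(\kappa)=\{X\subseteq\kappa:\ X\text{ is not }\Pi^1_\xi\text{-indescribable}\}\] is a nontrivial normal ideal on $\kappa$.
   Context: Canonical functions. For every regular cardinal $\kappa$ and every ordinal $\xi$ with $\kappa\le\xi<\kappa^+$ fix a bijection $b_{\kappa,\xi}:\kappa\to\xi$, with $b_{\kappa,\kappa}=\mathrm{id}_\kappa$. For $\xi<\kappa^+$ and $\alpha<\kappa$ let $F^\kappa_\xi(\alpha)=\xi$ if $\xi<\kappa$, and $F^\kappa_\xi(\alpha)=b_{\kappa,\xi}[\alpha]$ if $\kappa\le\xi<\kappa^+$. Let $f^\kappa_\xi(\alpha)=\mathrm{ot}(F^\kappa_\xi(\alpha))$ and let $\pi^\kappa_{\xi,\alpha}:F^\kappa_\xi(\alpha)\to f^\kappa_\xi(\alpha)$ be the transitive collapse. Formulas. A formula is $\Pi^1_0$ (equivalently $\Sigma^1_0$) over $V_\kappa$ if it is a first-order formula of set theory (only first-order quantifiers) in which free variables and parameters of two types may occur: first-order ones (ranging over, resp. being, elements of $V_\kappa$) and second-order ones (ranging over, resp. being, subsets of $V_\kappa$). It is $\Pi^1_{\xi+1}$ over $V_\kappa$ if it has the form $\forall X_{k_1}\cdots\forall X_{k_m}\psi$ with $\psi$ a $\Sigma^1_\xi$ formula over $V_\kappa$, and $\Sigma^1_{\xi+1}$ if it has the form $\exists X_{k_1}\cdots\exists X_{k_m}\psi$ with $\psi$ a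 $\Pi^1_\xi$ formula over $V_\kappa$ ($m\in\omega$; second-order quantifiers). For $\xi$ a limit, a formula with finitely many second-order free variables and finitely many second-order parameters is $\Pi^1_\xi$ over $V_\kappa$ if it has the form $\bigwedge_{\zeta<\xi}\varphi_\zeta$ with each $\varphi_\zeta$ being $\Pi^1_\zeta$ over $V_\kappa$, and $\Sigma^1_\xi$ if it has the form $\bigvee_{\zeta<\xi}\varphi_\zeta$ with each $\varphi_\zeta$ being $\Sigma^1_\zeta$ over $V_\kappa$. Restriction. For $\varphi$ a $\Pi^1_\xi$ or $\Sigma^1_\xi$ formula over $V_\kappa$, $\xi<\kappa^+$, and $\alpha<\kappa$ regular, $\varphi|^\kappa_\alpha$ is defined by recursion on $\xi$. If $\xi<\kappa$, replace each second-order parameter $A_i$ by $A_i\cap V_\alpha$. If $\xi=\zeta+1\geq\kappa$, the restriction of $\forall\vec X\psi$ is $\forall\vec X(\psi|^\kappa_\alpha)$ and that of $\exists\vec X\psi$ is $\exists\vec X(\psi|^\kappa_\alpha)$. If $\xi\ge\kappa$ is a limit and $\varphi=\bigwedge_{\zeta<\xi}\psi_\zeta$, then $\varphi|^\kappa_\alpha=\bigwedge_{\zeta<f^\kappa_\xi(\alpha)}\psi_{(\pi^\kappa_{\xi,\alpha})^{-1}(\zeta)}|^\kappa_\alpha$, provided $\psi_{(\pi^\kappa_{\xi,\alpha})^{-1}(\zeta)}|^\kappa_\alpha$ is a $\Pi^1_\zeta$ formula over $V_\alpha$ for every $\zeta<f^\kappa_\xi(\alpha)$; otherwise undefined. Similarly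 for $\Sigma^1_\xi$ with $\bigvee$. Indescribability. For a cardinal $\kappa$ and $\xi<\kappa^+$, a set $S\subseteq\kappa$ is $\Pi^1_\xi$-indescribable (in $\kappa$) if for every $\Pi^1_\xi$ sentence $\varphi$ over $V_\kappa$ (parameters allowed), if $V_\kappa\models\varphi$ then there is some $\alpha\in S$ with $V_\alpha\models\varphi|^\kappa_\alpha$ (which includes that $\varphi|^\kappa_\alpha$ is defined and is a formula over $V_\alpha$). The cardinal $\kappa$ is $\Pi^1_\xi$-indescribable if $S=\kappa$ is. An ideal $I$ on $\kappa$ is nontrivial if $\kappa\notin I$; it is normal if for every $S\in P(\kappa)\setminus I$ and every $f:S\to\kappa$ with $f(\alpha)<\alpha$ for all $\alpha\in S$ there is $T\subseteq S$, $T\notin I$, on which $f$ is constant. *)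

(* Defs.v *)
From Stdlib Require Import List ClassicalEpsilon FunctionalExtensionality
  PropExtensionality ProofIrrelevance.

Set Implicit Arguments.
Unset Strict Implicit.
Unset Printing Implicit Defensive.

(* A universe of sets: a type with a membership relation satisfying the axioms
   of ZFC.  Separation, replacement and foundation are the full second-order
   axioms, so for [x : U] every [P : U -> Prop] cuts out a set [sep x P], and
   the set functions with domain [x] are exactly the restrictions to [x] of the
   functions [U -> U].  [zfc_nonempty], at the end of this file, shows that
   such universes exist. *)

Record zfc : Type := Zfc {
  carrier :> Type;
  mem : carrier -> carrier -> Prop;
  empty : carrier;
  pair : carrier -> carrier -> carrier;
  union : carrier -> carrier;
  power : carrier -> carrier;
  sep : carrier -> (carrier -> Prop) -> carrier;
  image : (carrier -> carrier) -> carrier -> carrier;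
  omega : carrier;
  mem_ext : forall x y, (forall z, mem z x <-> mem z y) -> x = y;
  mem_wf : well_founded mem;
  mem_empty : forall z, ~ mem z empty;
  mem_pair : forall x y z, mem z (pair x y) <-> z = x \/ z = y;
  mem_union : forall x z, mem z (union x) <-> exists y, mem y x /\ mem z y;
  mem_power : forall x z,
    mem z (power x) <-> (forall y, mem y z -> mem y x);
  mem_sep : forall x P z, mem z (sep x P) <-> mem z x /\ P z;
  mem_image : forall f x z,
    mem z (image f x) <-> exists y, mem y x /\ z = f y;
  mem_omega : forall z, mem z omega <->
    exists n : nat, z = Nat.iter n (fun y => union (pair y (pair y y))) empty;
  choice : forall x, (forall y, mem y x -> exists z, mem z y) ->
    exists c : carrier -> carrier, forall y, mem y x -> mem (c y) y
}.

Arguments mem {_} _ _.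
Arguments empty {_}.
Arguments omega {_}.

Declare Scope zfc_scope.
Open Scope zfc_scope.

Notation "x '∈' y" := (mem x y) (at level 70, no associativity) : zfc_scope.
Notation "x '∉' y" := (~ mem x y) (at level 70, no associativity) : zfc_scope.

Definition subset {U : zfc} (x y : U) : Prop := forall z, z ∈ x -> z ∈ y.

Notation "x '⊆' y" := (subset x y) (at level 70, no associativity) : zfc_scope.

Definition inter {U : zfc} (x y : U) : U := sep x (fun z => z ∈ y).

Definition union2 {U : zfc} (x y : U) : U := union (pair x y).

Definition succ {U : zfc} (x : U) : U := union2 x (pair x x).

(* Recursion on membership: [mem_rec G x = G x (mem_rec G restricted to x)]. *)
Definition mem_rec {U : zfc} (G : U -> (U -> U) -> U) : U -> U :=
  Fix (@mem_wf U) (fun _ => carrier U)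
    (fun x rec => G x (fun y =>
       match excluded_middle_informative (y ∈ x) with
       | left h => rec y h
       | right _ => empty
       end)).

Lemma mem_rec_eq {U : zfc} (G : U -> (U -> U) -> U) (x : U) :
  mem_rec G x =
  G x (fun y => if excluded_middle_informative (y ∈ x)
                then mem_rec G y else empty).
Proof.
unfold mem_rec at 1; rewrite Fix_eq.
- reflexivity.
- intros y f g H; f_equal; apply functional_extensionality; intro z.
  destruct (excluded_middle_informative (z ∈ y)); auto.
Qed.

Definition transitive {U : zfc} (x : U) : Prop := forall y, y ∈ x -> y ⊆ x.

Definition ordinal {U : zfc} (x : U) : Prop :=
  transitive x /\ forall y, y ∈ x -> transitive y.

Definition limit {U : zfc} (x : U) : Prop :=
  ordinal x /\ x <> empty /\ forall y, y ∈ x -> succ y ∈ x.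

Definition bijection {U : zfc} (f : U -> U) (x y : U) : Prop :=
  (forall a, a ∈ x -> f a ∈ y) /\
  (forall a a', a ∈ x -> a' ∈ x -> f a = f a' -> a = a') /\
  (forall c, c ∈ y -> exists a, a ∈ x /\ f a = c).

Definition cardinal {U : zfc} (k : U) : Prop :=
  ordinal k /\ forall a, a ∈ k -> ~ exists f, bijection f a k.

Definition regular {U : zfc} (k : U) : Prop :=
  cardinal k /\ omega ⊆ k /\
  forall (a : U) (f : U -> U), a ∈ k -> (forall c, c ∈ a -> f c ∈ k) ->
    exists d, d ∈ k /\ forall c, c ∈ a -> f c ∈ d.

Definition card_succ {U : zfc} (k kp : U) : Prop :=
  cardinal kp /\ k ∈ kp /\
  forall l, cardinal l -> k ∈ l -> kp ⊆ l.

(* The cumulative hierarchy: [V a] is the union of the [power (V c)], [c ∈ a]. *)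
Definition V {U : zfc} : U -> U :=
  mem_rec (fun a v => union (image (fun c => power (v c)) a)).

Definition collapse {U : zfc} (F : U) : U -> U :=
  mem_rec (fun x c => image c (inter x F)).

Definition ot {U : zfc} (F : U) : U := image (collapse F) F.

(* The element of [F] which [collapse F] sends to [z], for [z ∈ ot F]; it is
   written as the union of the singleton consisting of that element. *)
Definition collapse_inv {U : zfc} (F z : U) : U :=
  union (sep F (fun x => collapse F x = z)).

Definition canonical_bijections {U : zfc} (b : U -> U -> U -> U) : Prop :=
  forall k : U, regular k ->
    (forall kp x, card_succ k kp -> x ∈ kp -> k ⊆ x -> bijection (b k x) k x) /\
    (forall a, a ∈ k -> b k k a = a).

Definition canF {U : zfc} (b : U -> U -> U -> U) (k x a : U) : U :=
  if excluded_middle_informative (x ∈ k) then x else image (b k x) a.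

Definition canf {U : zfc} (b : U -> U -> U -> U) (k x a : U) : U :=
  ot (canF b k x a).

Definition canpi_inv {U : zfc} (b : U -> U -> U -> U) (k x a z : U) : U :=
  collapse_inv (canF b k x a) z.

Inductive term1 (U : zfc) : Type :=
| Var1 (n : nat)
| Par1 (a : U).

Inductive term2 (U : zfc) : Type :=
| Var2 (n : nat)
| Par2 (A : U).

Arguments Var1 {U} n.
Arguments Var2 {U} n.

Inductive fo (U : zfc) : Type :=
| Eq (s t : term1 U)
| Mem (s t : term1 U)
| In2 (s : term1 U) (T : term2 U)
| Bot
| Imp (p q : fo U)
| All1 (n : nat) (p : fo U).

(* In [Conj x p] and [Disj x p] only the values of [p] at the elements of [x]
   matter. *)
Inductive formula (U : zfc) : Type :=
| FO (p : fo U)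
| All2 (n : nat) (p : formula U)
| Ex2 (n : nat) (p : formula U)
| Conj (x : U) (p : U -> formula U)
| Disj (x : U) (p : U -> formula U).

Definition term1_fv {U : zfc} (t : term1 U) (i : nat) : Prop :=
  match t with Var1 n => i = n | Par1 _ => False end.

Definition term1_par {U : zfc} (t : term1 U) (a : U) : Prop :=
  match t with Var1 _ => False | Par1 c => a = c end.

Definition term2_fv {U : zfc} (T : term2 U) (i : nat) : Prop :=
  match T with Var2 n => i = n | Par2 _ => False end.

Definition term2_par {U : zfc} (T : term2 U) (A : U) : Prop :=
  match T with Var2 _ => False | Par2 C => A = C end.

Fixpoint fo_fv1 {U : zfc} (p : fo U) (i : nat) : Prop :=
  match p with
  | Eq s t | Mem s t => term1_fv s i \/ term1_fv t i
  | In2 s _ => term1_fv s i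
  | Bot _ => False
  | Imp p q => fo_fv1 p i \/ fo_fv1 q i
  | All1 n p => i <> n /\ fo_fv1 p i
  end.

Fixpoint fo_par1 {U : zfc} (p : fo U) (a : U) : Prop :=
  match p with
  | Eq s t | Mem s t => term1_par s a \/ term1_par t a
  | In2 s _ => term1_par s a
  | Bot _ => False
  | Imp p q => fo_par1 p a \/ fo_par1 q a
  | All1 _ p => fo_par1 p a
  end.

Fixpoint fo_fv2 {U : zfc} (p : fo U) (i : nat) : Prop :=
  match p with
  | Eq _ _ | Mem _ _ | Bot _ => False
  | In2 _ T => term2_fv T i
  | Imp p q => fo_fv2 p i \/ fo_fv2 q i
  | All1 _ p => fo_fv2 p i
  end.

Fixpoint fo_par2 {U : zfc} (p : fo U) (A : U) : Prop :=
  match p with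
  | Eq _ _ | Mem _ _ | Bot _ => False
  | In2 _ T => term2_par T A
  | Imp p q => fo_par2 p A \/ fo_par2 q A
  | All1 _ p => fo_par2 p A
  end.

Fixpoint fv1 {U : zfc} (p : formula U) (i : nat) : Prop :=
  match p with
  | FO p => fo_fv1 p i
  | All2 _ p | Ex2 _ p => fv1 p i
  | Conj x p | Disj x p => exists z, z ∈ x /\ fv1 (p z) i
  end.

Fixpoint fv2 {U : zfc} (p : formula U) (i : nat) : Prop :=
  match p with
  | FO p => fo_fv2 p i
  | All2 n p | Ex2 n p => i <> n /\ fv2 p i
  | Conj x p | Disj x p => exists z, z ∈ x /\ fv2 (p z) i
  end.

Fixpoint par2 {U : zfc} (p : formula U) (A : U) : Prop :=
  match p with
  | FO p => fo_par2 p A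
  | All2 _ p | Ex2 _ p => par2 p A
  | Conj x p | Disj x p => exists z, z ∈ x /\ par2 (p z) A
  end.

Definition sentence {U : zfc} (p : formula U) : Prop :=
  (forall i, ~ fv1 p i) /\ (forall i, ~ fv2 p i).

Definition finitely_many {A : Type} (P : A -> Prop) : Prop :=
  exists l : list A, forall a, P a -> In a l.

Definition fo_over {U : zfc} (k : U) (p : fo U) : Prop :=
  (forall a, fo_par1 p a -> a ∈ V k) /\ (forall A, fo_par2 p A -> A ⊆ V k).

Inductive is_Pi {U : zfc} (k : U) : U -> formula U -> Prop :=
| Pi_zero p : fo_over k p -> is_Pi k empty (FO p)
| Pi_succ x (ns : list nat) p :
    is_Sigma k x p -> is_Pi k (succ x) (fold_right (@All2 U) p ns)
| Pi_limit x p :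
    limit x -> (forall z, z ∈ x -> is_Pi k z (p z)) ->
    finitely_many (fv2 (Conj x p)) -> finitely_many (par2 (Conj x p)) ->
    is_Pi k x (Conj x p)
with is_Sigma {U : zfc} (k : U) : U -> formula U -> Prop :=
| Sigma_zero p : fo_over k p -> is_Sigma k empty (FO p)
| Sigma_succ x (ns : list nat) p :
    is_Pi k x p -> is_Sigma k (succ x) (fold_right (@Ex2 U) p ns)
| Sigma_limit x p :
    limit x -> (forall z, z ∈ x -> is_Sigma k z (p z)) ->
    finitely_many (fv2 (Disj x p)) -> finitely_many (par2 (Disj x p)) ->
    is_Sigma k x (Disj x p).

Definition formula_over {U : zfc} (k : U) (p : formula U) : Prop :=
  exists x, is_Pi k x p \/ is_Sigma k x p.

Definition upd {A : Type} (s : nat -> A) (n : nat) (a : A) : nat -> A :=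
  fun i => if Nat.eqb i n then a else s i.

Definition eval1 {U : zfc} (s : nat -> U) (t : term1 U) : U :=
  match t with Var1 n => s n | Par1 a => a end.

Definition eval2 {U : zfc} (s : nat -> U) (T : term2 U) : U :=
  match T with Var2 n => s n | Par2 A => A end.

Fixpoint fo_sat {U : zfc} (k : U) (s1 s2 : nat -> U) (p : fo U) : Prop :=
  match p with
  | Eq s t => eval1 s1 s = eval1 s1 t
  | Mem s t => eval1 s1 s ∈ eval1 s1 t
  | In2 s T => eval1 s1 s ∈ eval2 s2 T
  | Bot _ => False
  | Imp p q => fo_sat k s1 s2 p -> fo_sat k s1 s2 q
  | All1 n p => forall a, a ∈ V k -> fo_sat k (upd s1 n a) s2 p
  end.

Fixpoint sat {U : zfc} (k : U) (s1 s2 : nat -> U) (p : formula U) : Prop :=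
  match p with
  | FO p => fo_sat k s1 s2 p
  | All2 n p => forall X, X ⊆ V k -> sat k s1 (upd s2 n X) p
  | Ex2 n p => exists X, X ⊆ V k /\ sat k s1 (upd s2 n X) p
  | Conj x p => forall z, z ∈ x -> sat k s1 s2 (p z)
  | Disj x p => exists z, z ∈ x /\ sat k s1 s2 (p z)
  end.

(* Truth of a sentence in [V k]; the assignment is irrelevant. *)
Definition models {U : zfc} (k : U) (p : formula U) : Prop :=
  sat k (fun _ => empty) (fun _ => empty) p.

(* The restriction is computed by recursion on the formula.  For a formula of
   level [x] over [V k] this is the recursion on [x]: the index [x] of
   [Conj x p] and [Disj x p] is the level of that subformula, and replacing
   the parameters of a formula of level below [k] amounts to replacing them in
   all of its subformulas.  The partiality of the restriction is expressed by
   [restr_defined]. *)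

Fixpoint fo_restr {U : zfc} (a : U) (p : fo U) : fo U :=
  match p with
  | In2 s (Par2 A) => In2 s (Par2 (inter A (V a)))
  | Eq _ _ | Mem _ _ | In2 _ (Var2 _) | Bot _ => p
  | Imp p q => Imp (fo_restr a p) (fo_restr a q)
  | All1 n p => All1 n (fo_restr a p)
  end.

Fixpoint restr {U : zfc} (b : U -> U -> U -> U) (k a : U) (p : formula U) :
    formula U :=
  match p with
  | FO p => FO (fo_restr a p)
  | All2 n p => All2 n (restr b k a p)
  | Ex2 n p => Ex2 n (restr b k a p)
  | Conj x p =>
      if excluded_middle_informative (x ∈ k)
      then Conj x (fun z => restr b k a (p z))
      else Conj (canf b k x a) (fun z => restr b k a (p (canpi_inv b k x a z)))
  | Disj x p =>
      if excluded_middle_informative (x ∈ k)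
      then Disj x (fun z => restr b k a (p z))
      else Disj (canf b k x a) (fun z => restr b k a (p (canpi_inv b k x a z)))
  end.

(* [regular k] is required at the levels [x >= k] because the canonical
   functions exist only for regular [k]. *)
Fixpoint restr_defined {U : zfc} (b : U -> U -> U -> U) (k a : U)
    (p : formula U) : Prop :=
  match p with
  | FO _ => True
  | All2 _ p | Ex2 _ p => restr_defined b k a p
  | Conj x p =>
      x ∈ k \/
      (regular k /\ forall z, z ∈ canf b k x a ->
         restr_defined b k a (p (canpi_inv b k x a z)) /\
         is_Pi a z (restr b k a (p (canpi_inv b k x a z))))
  | Disj x p =>
      x ∈ k \/
      (regular k /\ forall z, z ∈ canf b k x a ->
         restr_defined b k a (p (canpi_inv b k x a z)) /\
         is_Sigma a z (restr b k a (p (canpi_inv b k x a z))))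
  end.

(* Restrictions to [a] are only defined for regular [a < k]. *)
Definition indescribable {U : zfc} (b : U -> U -> U -> U) (k x S : U) : Prop :=
  forall p : formula U, is_Pi k x p -> sentence p -> models k p ->
    exists a, a ∈ S /\ a ∈ k /\ regular a /\
      restr_defined b k a p /\ formula_over a (restr b k a p) /\
      models a (restr b k a p).

Definition indescribable_ideal {U : zfc} (b : U -> U -> U -> U) (k x : U) : U :=
  sep (power k) (fun X => ~ indescribable b k x X).

Definition ideal {U : zfc} (k I : U) : Prop :=
  I ⊆ power k /\ empty ∈ I /\
  (forall X Y, X ∈ I -> Y ⊆ X -> Y ∈ I) /\
  (forall X Y, X ∈ I -> Y ∈ I -> union2 X Y ∈ I).

Definition nontrivial_ideal {U : zfc} (k I : U) : Prop := k ∉ I.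

Definition normal_ideal {U : zfc} (k I : U) : Prop :=
  forall (S : U) (f : U -> U),
    S ∈ power k -> S ∉ I -> (forall a, a ∈ S -> f a ∈ a) ->
    exists T, T ⊆ S /\ T ∉ I /\ exists c, forall a, a ∈ T -> f a = c.

(* A universe of sets: well-founded trees modulo extensional equality. *)

Inductive tree : Type := node (A : Type) (f : A -> tree).

Fixpoint teq (s t : tree) : Prop :=
  match s, t with
  | node f, node g =>
      (forall a, exists c, teq (f a) (g c)) /\
      (forall c, exists a, teq (f a) (g c))
  end.

Definition tmem (s t : tree) : Prop :=
  match t with node g => exists c, teq s (g c) end.

Lemma teq_refl s : teq s s.
Proof. induction s as [A f IH]; simpl; split; intro a; exists a; auto. Qed.

Lemma teq_sym s t : teq s t -> teq t s.
Proof.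
revert t; induction s as [A f IH]; intros [B g]; simpl; intros [H1 H2]; split.
- intro c; destruct (H2 c) as [a Ha]; exists a; auto.
- intro a; destruct (H1 a) as [c Hc]; exists c; auto.
Qed.

Lemma teq_trans s t u : teq s t -> teq t u -> teq s u.
Proof.
revert t u; induction s as [A f IH]; intros [B g] [C h]; simpl.
intros [H1 H2] [H3 H4]; split.
- intro a; destruct (H1 a) as [c Hc]; destruct (H3 c) as [d Hd]; eauto.
- intro d; destruct (H4 d) as [c Hc]; destruct (H2 c) as [a Ha]; eauto.
Qed.

Definition tset : Type := {P : tree -> Prop | exists s, P = teq s}.

Definition cls (s : tree) : tset := exist _ (teq s) (ex_intro _ s eq_refl).

Definition rep (x : tset) : tree :=
  proj1_sig (constructive_indefinite_description _ (proj2_sig x)).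

Lemma cls_eq s t : teq s t -> cls s = cls t.
Proof.
intro H; apply eq_sig_hprop; [intros; apply proof_irrelevance|simpl].
apply functional_extensionality; intro u; apply propositional_extensionality.
split; intro H'; [apply teq_trans with s|apply teq_trans with t]; auto.
now apply teq_sym.
Qed.

Lemma cls_inj s t : cls s = cls t -> teq s t.
Proof.
intro H; apply (f_equal (@proj1_sig _ _)) in H; simpl in H.
rewrite H; apply teq_refl.
Qed.

Lemma repK x : cls (rep x) = x.
Proof.
unfold rep; destruct constructive_indefinite_description as [s Hs]; simpl.
apply eq_sig_hprop; [intros; apply proof_irrelevance|now simpl].
Qed.

Definition smem (x y : tset) : Prop := tmem (rep x) (rep y).

Lemma tmem_teq s s' t t' : teq s s' -> teq t t' -> tmem s t -> tmem s' t'.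
Proof.
destruct t as [A f], t' as [B g]; simpl; intros Hs [H _] [a Ha].
destruct (H a) as [c Hc]; exists c.
apply teq_trans with s; [now apply teq_sym|].
now apply teq_trans with (f a).
Qed.

Definition mkset (A : Type) (f : A -> tset) : tset :=
  cls (node (fun a => rep (f a))).

Lemma mem_mkset A (f : A -> tset) z : smem z (mkset f) <-> exists a, z = f a.
Proof.
assert (E : teq (rep (mkset f)) (node (fun a => rep (f a)))).
{ apply cls_inj; now rewrite repK. }
unfold smem; split.
- intro H; apply (tmem_teq (teq_refl _) E) in H; destruct H as [a Ha].
  exists a; rewrite <- (repK z), <- (repK (f a)); now apply cls_eq.
- intros [a ->]; apply (tmem_teq (teq_refl _) (teq_sym E)).
  exists a; apply teq_refl.
Qed.

Definition dom (s : tree) : Type := match s with @node A _ => A end.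

Definition sub (s : tree) : dom s -> tset :=
  match s with node f => fun a => cls (f a) end.

Definition elt (x : tset) : dom (rep x) -> tset := @sub (rep x).

Lemma mem_elt x z : smem z x <-> exists a, z = elt (x := x) a.
Proof.
unfold smem, elt; destruct (rep x) as [A f]; simpl; split; intros [a Ha];
  exists a.
- rewrite <- (repK z); now apply cls_eq.
- apply cls_inj; now rewrite repK.
Qed.

Lemma smem_ext x y : (forall z, smem z x <-> smem z y) -> x = y.
Proof.
intro H; rewrite <- (repK x), <- (repK y); apply cls_eq.
assert (H1 : forall z, smem z x -> smem z y) by (intros; now apply H).
assert (H2 : forall z, smem z y -> smem z x) by (intros; now apply H).
clear H; unfold smem in *.
destruct (rep x) as [A f], (rep y) as [B g]; simpl in *; split.
- intro a; destruct (H1 (cls (f a))) as [c Hc].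
  { exists a; apply cls_inj; now rewrite repK. }
  exists c; refine (teq_trans _ Hc); apply cls_inj; now rewrite repK.
- intro c; destruct (H2 (cls (g c))) as [a Ha].
  { exists c; apply cls_inj; now rewrite repK. }
  exists a; apply teq_sym; refine (teq_trans _ Ha); apply cls_inj.
  now rewrite repK.
Qed.

Lemma smem_wf : well_founded smem.
Proof.
assert (H : forall s x, teq s (rep x) -> Acc smem x).
{ induction s as [A f IH]; intros x Hx; constructor; intros y Hy.
  apply (tmem_teq (teq_refl _) (teq_sym Hx)) in Hy; destruct Hy as [a Ha].
  apply (IH a); now apply teq_sym. }
intro x; apply (H (rep x)); apply teq_refl.
Qed.

Definition sempty : tset := mkset (fun e : False => match e with end).

Definition spair (x y : tset) : tset := mkset (fun c : bool => if c then x else y).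

Definition sunion (x : tset) : tset :=
  mkset (fun c : sigT (fun a : dom (rep x) => dom (rep (elt a))) =>
           elt (projT2 c)).

Lemma zfc_nonempty : inhabited zfc.
Proof.
constructor.
unshelve refine (@Zfc tset smem sempty spair sunion
  (fun x => mkset (fun P : dom (rep x) -> Prop =>
                     mkset (fun a : {a | P a} => elt (proj1_sig a))))
  (fun x P => mkset (fun a : {a : dom (rep x) | P (elt a)} =>
                       elt (proj1_sig a)))
  (fun f x => mkset (fun a : dom (rep x) => f (elt a)))
  (mkset (fun n : nat =>
            Nat.iter n (fun y => sunion (spair y (spair y y))) sempty))
  smem_ext smem_wf _ _ _ _ _ _ _ _).
- intros z H; apply mem_mkset in H; now destruct H as [[] _].
- intros x y z; unfold spair; rewrite mem_mkset; split.
  + intros [[] ->]; auto.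
  + intros [->| ->]; [exists true|exists false]; reflexivity.
- intros x z; unfold sunion; rewrite mem_mkset; split.
  + intros [[a c] ->]; exists (elt a); split; apply mem_elt; eauto.
  + intros [y [Hy Hz]]; apply mem_elt in Hy; destruct Hy as [a ->].
    apply mem_elt in Hz; destruct Hz as [c ->]; now exists (existT _ a c).
- intros x z; rewrite mem_mkset; split.
  + intros [P ->] y Hy; apply mem_mkset in Hy; destruct Hy as [[a Ha] ->].
    apply mem_elt; eauto.
  + intro H; exists (fun a => smem (elt a) z); apply smem_ext; intro y.
    rewrite mem_mkset; split.
    * intro Hy; assert (Hx := H y Hy); apply mem_elt in Hx.
      destruct Hx as [a ->]; now exists (exist _ a Hy).
    * now intros [[a Ha] ->].
- intros x P z; rewrite mem_mkset; split.
  + intros [[a Ha] ->]; split; [apply mem_elt; eauto|exact Ha].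
  + intros [Hz HP]; apply mem_elt in Hz; destruct Hz as [a ->].
    now exists (exist _ a HP).
- intros f x z; rewrite mem_mkset; split.
  + intros [a ->]; exists (elt a); split; [apply mem_elt; eauto|auto].
  + intros [y [Hy ->]]; apply mem_elt in Hy; destruct Hy as [a ->]; eauto.
- intro z; apply mem_mkset.
- intros x H.
  exists (fun y => match excluded_middle_informative (exists z, smem z y) with
    | left h => proj1_sig (constructive_indefinite_description _ h)
    | right _ => y end).
  intros y Hy; destruct excluded_middle_informative as [h|h].
  + exact (proj2_sig (constructive_indefinite_description _ h)).
  + now destruct h; apply H.
Qed.

(* Main.v *)
(* First-order reflection already makes [kappa] regular and shows that an
   indescribable set contains, for every [h] from [V kappa] to [V kappa], a
   reflection point [a] with [V a] closed under [h].  Normality therefore reduces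
   to combining a family of true Pi_xi sentences [f i], [i ∈ V kappa], into one
   true Pi_xi sentence whose restriction to [a], for all [a] closed under a
   suitable [h], implies the restrictions of [f i] for [i ∈ V a].  At level 0 the
   family is replaced by elementarity of [V a] in [V kappa], at limit levels the
   conjuncts are combined one by one, and at a successor level "for all [i]" is
   absorbed by the leading second-order quantifiers.  The last step rests on
   formulas of each positive level which, given a code of [i], select the truth
   value of [f i]: a bottom quantifier over truth predicates evaluates the
   first-order part, quantifiers are copied, and limits are taken conjunct by
   conjunct. *)

From Stdlib Require Import List Arith Lia Classical ClassicalEpsilon
  FunctionalExtensionality.
Require Import Defs.

Set Implicit Arguments.
Unset Strict Implicit.
Unset Printing Implicit Defensive.

(** * Sets *)

Section Sets.
Context {U : zfc}.
Implicit Types x y z w a c d F : U.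

(** Two features of the hierarchy shape the argument. A formula of limit level has only finitely
    many second-order parameters, so sentences found separately for the conjuncts cannot simply be
    conjoined; their parameters are first coded into one set. And infinite levels are not
    cumulative: a Pi formula of an infinite level is in general not a Pi formula of the next one, so
    each construction must return exactly the level it started from, also after restriction, when
    level [x] becomes [canf b k x a].

    What is true of restrictions is true only for almost all [a]. Here almost all means: for all
    regular [a] with [V a] closed under some fixed function. That is a first-order property with the
    graph of the function as parameter, so an indescribable set contains such an [a], and diagonal
    intersections amount to coding a family of functions as one function on ordered pairs.

    An index [i] in [V a] is also a subset of [V a], so it can be its own code as the value of a
    second-order variable. *)

Lemma mem_inter x y z : z ∈ inter x y <-> z ∈ x /\ z ∈ y.
Proof. unfold inter; now rewrite mem_sep. Qed.

Lemma mem_succ x z : z ∈ succ x <-> z ∈ x \/ z = x.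
Proof.
unfold succ, union2; rewrite mem_union; split.
- intros [y [Hy Hz]]; apply mem_pair in Hy; destruct Hy as [->| ->]; auto.
  apply mem_pair in Hz; tauto.
- intros [H| ->]; [exists x|exists (pair x x)]; rewrite !mem_pair; auto.
Qed.

Lemma subset_antisym x y : x ⊆ y -> y ⊆ x -> x = y.
Proof. intros H1 H2; apply mem_ext; intro z; split; auto. Qed.

Lemma mem_irrefl x : x ∉ x.
Proof.
induction x as [x IH] using (well_founded_ind (@mem_wf U)); intro H.
exact (IH x H H).
Qed.

Lemma mem_asym x y : x ∈ y -> y ∉ x.
Proof.
revert y; induction x as [x IH] using (well_founded_ind (@mem_wf U)).
intros y H H'; exact (IH y H' x H' H).
Qed.

Lemma empty_or_inhabited x : x = empty \/ exists y, y ∈ x.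
Proof.
destruct (classic (exists y, y ∈ x)) as [H|H]; [now right|left].
apply mem_ext; intro z; split; intro Hz; [destruct H; eauto|].
now apply mem_empty in Hz.
Qed.

Lemma ordinal_mem x y : ordinal x -> y ∈ x -> ordinal y.
Proof.
intros [H1 H2] H; split; [auto|intros z Hz]; exact (H2 z (H1 y H z Hz)).
Qed.

Lemma ordinal_trans x y z : ordinal z -> x ∈ y -> y ∈ z -> x ∈ z.
Proof. intros [H _] Hx Hy; exact (H y Hy x Hx). Qed.

Lemma ordinal_trichotomy x y :
  ordinal x -> ordinal y -> x ∈ y \/ x = y \/ y ∈ x.
Proof.
revert y; induction x as [x IHx] using (well_founded_ind (@mem_wf U)).
intros y Ox; induction y as [y IHy] using (well_founded_ind (@mem_wf U)).
intros Oy.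
destruct (classic (x ⊆ y)) as [Hxy|Hxy].
- destruct (classic (y ⊆ x)) as [Hyx|Hyx].
  + right; left; now apply subset_antisym.
  + left; apply not_all_ex_not in Hyx; destruct Hyx as [z Hz].
    apply imply_to_and in Hz; destruct Hz as [Hz1 Hz2].
    destruct (IHy z Hz1 (ordinal_mem Oy Hz1)) as [H|[H|H]].
    * exact (ordinal_trans Oy H Hz1).
    * now subst.
    * contradiction.
- right; right; apply not_all_ex_not in Hxy; destruct Hxy as [z Hz].
  apply imply_to_and in Hz; destruct Hz as [Hz1 Hz2].
  destruct (IHx z Hz1 y (ordinal_mem Ox Hz1) Oy) as [H|[H|H]].
  + contradiction.
  + now subst.
  + exact (ordinal_trans Ox H Hz1).
Qed.

Lemma ordinal_not_mem x y : ordinal x -> ordinal y -> y ∉ x -> x ⊆ y.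
Proof.
intros Ox Oy H z Hz.
destruct (ordinal_trichotomy Ox Oy) as [H'|[->|H']]; try contradiction; auto.
exact (ordinal_trans Oy Hz H').
Qed.

Lemma ordinal_subset_mem x y z :
  ordinal x -> ordinal z -> x ⊆ y -> y ∈ z -> x ∈ z.
Proof.
intros Ox Oz H Hy; pose proof (ordinal_mem Oz Hy) as Oy.
destruct (ordinal_trichotomy Ox Oy) as [H'|[->|H']]; auto.
- exact (ordinal_trans Oz H' Hy).
- now apply H, mem_irrefl in H'.
Qed.

Lemma ordinal_succ x : ordinal x -> ordinal (succ x).
Proof.
intros [H1 H2]; split.
- intros y Hy z Hz; apply mem_succ; left.
  apply mem_succ in Hy; destruct Hy as [Hy| ->]; [exact (H1 y Hy z Hz)|auto].
- intros y Hy; apply mem_succ in Hy; destruct Hy as [Hy| ->]; auto.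
Qed.

Lemma ordinal_empty : ordinal (@empty U).
Proof. split; intros y Hy; now apply mem_empty in Hy. Qed.

Lemma mem_succ_self x : x ∈ succ x.
Proof. apply mem_succ; now right. Qed.

Lemma succ_inj x y : succ x = succ y -> x = y.
Proof.
intro H.
assert (H1 : x ∈ succ y) by (rewrite <- H; apply mem_succ_self).
assert (H2 : y ∈ succ x) by (rewrite H; apply mem_succ_self).
apply mem_succ in H1, H2; destruct H1, H2; subst; auto.
destruct (mem_asym H0 H1).
Qed.

Lemma ordinal_cases x : ordinal x ->
  x = empty \/ (exists y, ordinal y /\ x = succ y) \/ limit x.
Proof.
intro Ox; destruct (classic (x = empty)) as [H|H]; [now left|right].
destruct (classic (forall y, y ∈ x -> succ y ∈ x)) as [H'|H'].
- right; now split.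
- left; apply not_all_ex_not in H'; destruct H' as [y Hy].
  apply imply_to_and in Hy; destruct Hy as [Hy1 Hy2]; exists y.
  pose proof (ordinal_mem Ox Hy1) as Oy; split; auto.
  destruct (ordinal_trichotomy Ox (ordinal_succ Oy)) as [H'|[H'|H']]; auto.
  + apply mem_succ in H'; destruct H' as [H'| ->].
    * destruct (mem_asym H' Hy1).
    * destruct (mem_irrefl Hy1).
  + contradiction.
Qed.

Lemma limit_neq_succ x y : limit x -> x <> succ y.
Proof.
intros [_ [_ H]] ->; apply (@mem_irrefl (succ y)), H, mem_succ_self.
Qed.

Lemma limit_empty x : limit x -> empty ∈ x.
Proof.
intros [Ox [H _]]; destruct (ordinal_trichotomy ordinal_empty Ox) as [H'|[H'|H']].
- auto.
- now destruct H.
- now apply mem_empty in H'.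
Qed.

Lemma succ_neq_empty x : succ x <> empty.
Proof. intro H; apply (@mem_empty U x); rewrite <- H; apply mem_succ_self. Qed.

(** * Ordered pairs and numerals *)

Definition op x y : U := pair (pair x x) (pair x y).

Lemma pair_inj x y z w :
  pair x y = pair z w -> (x = z /\ y = w) \/ (x = w /\ y = z).
Proof.
intro H.
assert (Hx : x ∈ pair z w) by (rewrite <- H; apply mem_pair; auto).
assert (Hy : y ∈ pair z w) by (rewrite <- H; apply mem_pair; auto).
assert (Hz : z ∈ pair x y) by (rewrite H; apply mem_pair; auto).
assert (Hw : w ∈ pair x y) by (rewrite H; apply mem_pair; auto).
apply mem_pair in Hx, Hy, Hz, Hw.
intuition congruence.
Qed.

Lemma op_inj x y z w : op x y = op z w -> x = z /\ y = w.
Proof.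
intro H; apply pair_inj in H; destruct H as [[H1 H2]|[H1 H2]];
  apply pair_inj in H1, H2; intuition congruence.
Qed.

Lemma op_neq_empty x y : op x y <> empty.
Proof.
intro H; apply (@mem_empty U (pair x x)); rewrite <- H; apply mem_pair; auto.
Qed.

Definition num (n : nat) : U := Nat.iter n succ empty.

Lemma num_inj m n : num m = num n -> m = n.
Proof.
revert n; induction m as [|m IH]; intros [|n] H; auto.
- symmetry in H; now apply succ_neq_empty in H.
- now apply succ_neq_empty in H.
- f_equal; apply IH; now apply succ_inj.
Qed.

Lemma mem_omega_num z : z ∈ omega <-> exists n, z = num n.
Proof. now rewrite mem_omega. Qed.

Lemma limit_num x n : limit x -> num n ∈ x.
Proof.
intro H; induction n as [|n IH]; [now apply limit_empty|]; now apply H.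
Qed.

Lemma limit_cofinal x c d : limit x -> c ∈ x -> d ∈ x ->
  exists e, e ∈ x /\ c ∈ e /\ d ∈ e.
Proof.
intros [Ox [_ H]] Hc Hd; pose proof (ordinal_mem Ox Hc) as Oc.
pose proof (ordinal_mem Ox Hd) as Od.
destruct (ordinal_trichotomy Oc Od) as [H'|[->|H']].
- exists (succ d); rewrite !mem_succ; auto.
- exists (succ d); rewrite !mem_succ; auto.
- exists (succ c); rewrite !mem_succ; auto.
Qed.

(** * The cumulative hierarchy *)

Lemma mem_V a z : z ∈ V a <-> exists c, c ∈ a /\ z ⊆ V c.
Proof.
unfold V at 1; rewrite mem_rec_eq, mem_union; split.
- intros [y [Hy Hz]]; apply mem_image in Hy; destruct Hy as [c [Hc ->]].
  destruct (excluded_middle_informative (c ∈ a)); [|contradiction].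
  exists c; split; auto; intros w Hw; rewrite mem_power in Hz; now apply Hz.
- intros [c [Hc Hz]]; exists (power (V c)); split.
  + apply mem_image; exists c; split; auto.
    now destruct (excluded_middle_informative (c ∈ a)).
  + now apply mem_power.
Qed.

Lemma V_trans a x y : ordinal a -> y ∈ x -> x ∈ V a -> y ∈ V a.
Proof.
intros Oa Hy Hx; apply mem_V in Hx; destruct Hx as [c [Hc Hx]].
apply Hx, mem_V in Hy; destruct Hy as [d [Hd Hy]].
apply mem_V; exists d; split; auto; exact (ordinal_trans Oa Hd Hc).
Qed.

Lemma V_subset a x : ordinal a -> x ∈ V a -> x ⊆ V a.
Proof. intros Oa Hx y Hy; exact (V_trans Oa Hy Hx). Qed.

Lemma V_mono a c : a ⊆ c -> V a ⊆ V c.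
Proof.
intros H x Hx; apply mem_V in Hx; destruct Hx as [d [Hd Hx]].
apply mem_V; eauto.
Qed.

Lemma subset_V x : x ⊆ V x.
Proof.
induction x as [x IH] using (well_founded_ind (@mem_wf U)); intros y Hy.
apply mem_V; exists y; auto.
Qed.

Lemma ordinal_mem_V a x : ordinal a -> ordinal x -> x ∈ V a -> x ∈ a.
Proof.
revert x; induction a as [a IH] using (well_founded_ind (@mem_wf U)).
intros x Oa Ox Hx; apply mem_V in Hx; destruct Hx as [c [Hc Hx]].
apply (ordinal_subset_mem (y := c)); auto; intros y Hy.
apply IH; auto; [exact (ordinal_mem Oa Hc)|exact (ordinal_mem Ox Hy)].
Qed.

Lemma V_pair a x y : limit a -> x ∈ V a -> y ∈ V a -> pair x y ∈ V a.
Proof.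
intros La Hx Hy; apply mem_V in Hx, Hy; destruct Hx as [c [Hc Hx]], Hy as [d [Hd Hy]].
destruct (limit_cofinal La Hc Hd) as [e [He [Hce Hde]]].
apply mem_V; exists e; split; auto; intros z Hz; apply mem_pair in Hz.
apply mem_V; destruct Hz as [->| ->]; eauto.
Qed.

Lemma V_op a x y : limit a -> x ∈ V a -> y ∈ V a -> op x y ∈ V a.
Proof. intros La Hx Hy; repeat apply V_pair; auto. Qed.

Lemma V_op_inv a x y : ordinal a -> op x y ∈ V a -> x ∈ V a /\ y ∈ V a.
Proof.
intros Oa H.
assert (H' : pair x y ∈ V a).
{ apply V_trans with (x := op x y); auto; apply mem_pair; auto. }
split; apply V_trans with (x := pair x y); auto; apply mem_pair; auto.
Qed.

Lemma V_empty a : limit a -> empty ∈ V a.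
Proof. intro La; apply subset_V; now apply limit_empty. Qed.

Lemma V_num a n : limit a -> num n ∈ V a.
Proof. intro La; apply subset_V; now apply limit_num. Qed.

Lemma regular_limit a : regular a -> limit a.
Proof.
intros [[Oa _] [Hw Hr]]; split; auto; split.
- intros ->; apply (@mem_empty U (num 0)), Hw, mem_omega_num; eauto.
- intros y Hy; destruct (ordinal_cases Oa) as [->|[[c [Oc ->]]|La]].
  + now apply mem_empty in Hy.
  (* The constant function on [num 1] with value the predecessor [c] has no bound in [succ c]. *)
  + destruct (Hr (num 1) (fun _ => c)) as [d [Hd Hc]].
    * apply Hw, mem_omega_num; eauto.
    * intros; apply mem_succ_self.
    * specialize (Hc empty (mem_succ_self _)).
      apply mem_succ in Hd; destruct Hd as [Hd| ->].
      -- destruct (mem_asym Hc Hd).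
      -- destruct (mem_irrefl Hc).
  + now apply La.
Qed.

(** * Transitive collapses of sets of ordinals *)

Lemma mem_collapse F x y :
  y ∈ collapse F x <-> exists z, z ∈ x /\ z ∈ F /\ y = collapse F z.
Proof.
unfold collapse at 1; rewrite mem_rec_eq, mem_image; split.
- intros [z [Hz ->]]; apply mem_inter in Hz; destruct Hz as [H1 H2].
  exists z; destruct (excluded_middle_informative (z ∈ x)); [auto|contradiction].
- intros [z [H1 [H2 ->]]]; exists z; split; [now apply mem_inter|].
  destruct (excluded_middle_informative (z ∈ x)); [auto|contradiction].
Qed.

Lemma mem_ot F y : y ∈ ot F <-> exists z, z ∈ F /\ y = collapse F z.
Proof. unfold ot; now rewrite mem_image. Qed.

Lemma collapse_mono F y z : y ∈ z -> y ∈ F -> collapse F y ∈ collapse F z.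
Proof. intros; apply mem_collapse; eauto. Qed.

Lemma collapse_inj F x y z : ordinal x -> F ⊆ x -> y ∈ F -> z ∈ F ->
  collapse F y = collapse F z -> y = z.
Proof.
intros Ox HF Hy Hz E.
destruct (ordinal_trichotomy (ordinal_mem Ox (HF _ Hy)) (ordinal_mem Ox (HF _ Hz)))
  as [H|[H|H]]; auto; exfalso.
- apply (@mem_irrefl (collapse F y)); rewrite E at 2; now apply collapse_mono.
- apply (@mem_irrefl (collapse F z)); rewrite <- E at 2; now apply collapse_mono.
Qed.

Lemma collapse_invK F x z : ordinal x -> F ⊆ x -> z ∈ F ->
  collapse_inv F (collapse F z) = z.
Proof.
intros Ox HF Hz; apply mem_ext; intro w; unfold collapse_inv.
rewrite mem_union; split.
- intros [y [Hy Hw]]; apply mem_sep in Hy; destruct Hy as [Hy E].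
  now rewrite <- (collapse_inj Ox HF Hy Hz E).
- intro Hw; exists z; split; auto; now apply mem_sep.
Qed.

Lemma collapse_invP F x w : ordinal x -> F ⊆ x -> w ∈ ot F ->
  collapse_inv F w ∈ F /\ collapse F (collapse_inv F w) = w.
Proof.
intros Ox HF Hw; apply mem_ot in Hw; destruct Hw as [z [Hz ->]].
now rewrite (collapse_invK Ox HF Hz).
Qed.

Lemma ordinal_ot F x : ordinal x -> F ⊆ x -> ordinal (ot F).
Proof.
intros Ox HF; split.
- intros y Hy z Hz; apply mem_ot in Hy; destruct Hy as [w [Hw ->]].
  apply mem_collapse in Hz; destruct Hz as [v [_ [Hv ->]]].
  apply mem_ot; eauto.
- intros y Hy z Hz v Hv; apply mem_ot in Hy; destruct Hy as [w [Hw ->]].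
  apply mem_collapse in Hz; destruct Hz as [u [Hu [Hu' ->]]].
  apply mem_collapse in Hv; destruct Hv as [t [Ht [Ht' ->]]].
  apply collapse_mono; auto.
  exact (ordinal_trans (ordinal_mem Ox (HF _ Hw)) Ht Hu).
Qed.

Lemma collapse_ordinal F x z : ordinal x -> x ⊆ F -> z ∈ x -> collapse F z = z.
Proof.
intros Ox HF; induction z as [z IH] using (well_founded_ind (@mem_wf U)).
intro Hz; apply mem_ext; intro w; rewrite mem_collapse; split.
- intros [y [Hy [_ ->]]]; rewrite IH; auto; exact (ordinal_trans Ox Hy Hz).
- intro Hw; pose proof (ordinal_trans Ox Hw Hz) as Hwx.
  exists w; rewrite IH; auto.
Qed.

Lemma ot_ordinal x : ordinal x -> ot x = x.
Proof.
intro Ox; apply mem_ext; intro w; rewrite mem_ot; split.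
- intros [z [Hz ->]]; now rewrite (collapse_ordinal Ox).
- intro Hw; exists w; now rewrite (collapse_ordinal Ox).
Qed.

(** The collapse at [z] sees only the elements of [F] below [z]. Agreement of two sets below [z]
    thereby becomes an equation between an order type and a value of the collapse. *)
Lemma collapse_ot F z : ordinal z -> collapse F z = ot (inter F z).
Proof.
intro Oz.
assert (E : forall y, y ∈ z -> collapse F y = collapse (inter F z) y).
{ intro y; induction y as [y IH] using (well_founded_ind (@mem_wf U)); intro Hy.
  apply mem_ext; intro w; rewrite !mem_collapse; split.
  - intros [v [H1 [H2 ->]]]; exists v.
    assert (v ∈ z) by exact (ordinal_trans Oz H1 Hy); rewrite mem_inter; auto.
  - intros [v [H1 [H2 ->]]]; exists v; apply mem_inter in H2.
    destruct H2 as [H2 H3]; rewrite <- IH; auto. }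
apply mem_ext; intro w; rewrite mem_collapse, mem_ot; split.
- intros [v [H1 [H2 ->]]]; exists v; rewrite mem_inter; auto.
- intros [v [H ->]]; apply mem_inter in H; destruct H as [H1 H2].
  exists v; rewrite <- E; auto.
Qed.

End Sets.

(** * Formulas *)

Lemma mem_choice (U : zfc) (A : Type) (x : U) (R : U -> A -> Prop) :
  inhabited A -> (forall z, z ∈ x -> exists p, R z p) ->
  exists f, forall z, z ∈ x -> R z (f z).
Proof.
intros i H; exists (fun z => epsilon i (R z)); intros z Hz.
apply epsilon_spec; auto.
Qed.

(** * First-order formulas about ordered pairs *)

Section FirstOrder.
Context {U : zfc}.
Implicit Types (p q : fo U) (t : term1 U) (T : term2 U).

Definition fo_not p := Imp p (Bot U).
Definition fo_or p q := Imp (fo_not p) q.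
Definition fo_and p q := fo_not (Imp p (fo_not q)).
Definition fo_iff p q := fo_and (Imp p q) (Imp q p).
Definition fo_ex n p := fo_not (All1 n (fo_not p)).

Lemma sat_not a s1 s2 p : fo_sat a s1 s2 (fo_not p) <-> ~ fo_sat a s1 s2 p.
Proof. reflexivity. Qed.

Lemma sat_or a s1 s2 p q :
  fo_sat a s1 s2 (fo_or p q) <-> fo_sat a s1 s2 p \/ fo_sat a s1 s2 q.
Proof. simpl; tauto. Qed.

Lemma sat_and a s1 s2 p q :
  fo_sat a s1 s2 (fo_and p q) <-> fo_sat a s1 s2 p /\ fo_sat a s1 s2 q.
Proof. simpl; tauto. Qed.

Lemma sat_iff a s1 s2 p q :
  fo_sat a s1 s2 (fo_iff p q) <-> (fo_sat a s1 s2 p <-> fo_sat a s1 s2 q).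
Proof. simpl; tauto. Qed.

Lemma sat_ex a s1 s2 n p : fo_sat a s1 s2 (fo_ex n p) <->
  exists c, c ∈ V a /\ fo_sat a (upd s1 n c) s2 p.
Proof.
simpl; split; [|intros [c [H1 H2]] H; exact (H c H1 H2)].
intro H; apply NNPP; intro H'; apply H; intros c Hc Hp; apply H'; eauto.
Qed.

Lemma upd_same (A : Type) (s : nat -> A) n c : upd s n c n = c.
Proof. unfold upd; now rewrite Nat.eqb_refl. Qed.

Lemma upd_other (A : Type) (s : nat -> A) n m c : m <> n -> upd s n c m = s m.
Proof. intro H; unfold upd; now apply Nat.eqb_neq in H as ->. Qed.

Definition term_bound (n : nat) t : Prop :=
  match t with Var1 m => m < n | Par1 _ => True end.

Lemma eval1_upd s1 n c t : term_bound n t -> eval1 (upd s1 n c) t = eval1 s1 t.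
Proof. destruct t as [m|d]; simpl; auto; intro H; apply upd_other; lia. Qed.

Lemma term_bound_S n t : term_bound n t -> term_bound (S n) t.
Proof. destruct t; simpl; auto. Qed.

Definition is_pair w (s t : term1 U) : fo U :=
  All1 (S w) (fo_iff (Mem (Var1 (S w)) (Var1 w))
                     (fo_or (Eq (Var1 (S w)) s) (Eq (Var1 (S w)) t))).

Definition is_op z (s t : term1 U) : fo U :=
  All1 (S z) (fo_iff (Mem (Var1 (S z)) (Var1 z))
                     (fo_or (is_pair (S z) s s) (is_pair (S z) s t))).

Definition fresh (s t : term1 U) : nat :=
  match s, t with
  | Var1 m, Var1 n => S (Nat.max m n)
  | Var1 m, Par1 _ | Par1 _, Var1 m => S m
  | Par1 _, Par1 _ => 0
  end.

Definition rel s t T : fo U :=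
  fo_ex (fresh s t) (fo_and (is_op (fresh s t) s t) (In2 (Var1 (fresh s t)) T)).

Lemma sat_is_pair a s1 s2 w s t : ordinal a -> term_bound w s -> term_bound w t ->
  s1 w ∈ V a -> eval1 s1 s ∈ V a -> eval1 s1 t ∈ V a ->
  fo_sat a s1 s2 (is_pair w s t) <-> s1 w = pair (eval1 s1 s) (eval1 s1 t).
Proof.
intros Oa Bs Bt Hw Hs Ht; apply term_bound_S in Bs, Bt.
assert (E : fo_sat a s1 s2 (is_pair w s t) <->
  forall c, c ∈ V a -> (c ∈ s1 w <-> c = eval1 s1 s \/ c = eval1 s1 t)).
{ unfold is_pair; cbn [fo_sat].
  split; intros H c Hc; specialize (H c Hc); revert H;
    rewrite sat_iff, sat_or; cbn [fo_sat];
    rewrite (eval1_upd s1 c Bs), (eval1_upd s1 c Bt);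
    cbn [eval1]; now rewrite upd_same, upd_other by lia. }
rewrite E; split.
- intro H; apply mem_ext; intro c; rewrite mem_pair; split; intro Hc.
  + apply H; auto; exact (V_trans Oa Hc Hw).
  + apply H; auto; destruct Hc as [->| ->]; auto.
- intros -> c _; apply mem_pair.
Qed.

Lemma sat_is_op a s1 s2 z s t : limit a -> term_bound z s -> term_bound z t ->
  s1 z ∈ V a -> eval1 s1 s ∈ V a -> eval1 s1 t ∈ V a ->
  fo_sat a s1 s2 (is_op z s t) <-> s1 z = op (eval1 s1 s) (eval1 s1 t).
Proof.
intros La Bs Bt Hz Hs Ht; pose proof (proj1 La) as Oa.
apply term_bound_S in Bs, Bt.
assert (E : fo_sat a s1 s2 (is_op z s t) <->
  forall c, c ∈ V a -> (c ∈ s1 z <-> c = pair (eval1 s1 s) (eval1 s1 s) \/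
                                     c = pair (eval1 s1 s) (eval1 s1 t))).
{ unfold is_op; cbn [fo_sat].
  split; intros H c Hc; specialize (H c Hc); revert H;
    (rewrite sat_iff, sat_or, !sat_is_pair;
     rewrite ?(eval1_upd s1 c Bs), ?(eval1_upd s1 c Bt), ?upd_same; auto);
    cbn [fo_sat eval1]; now rewrite upd_same, upd_other by lia. }
rewrite E; split.
- intro H; apply mem_ext; intro c; unfold op; rewrite mem_pair; split; intro Hc.
  + apply H; auto; exact (V_trans Oa Hc Hz).
  + apply H; auto; destruct Hc as [->| ->]; now apply V_pair.
- intros -> c _; apply mem_pair.
Qed.

Lemma term_bound_fresh s t :
  term_bound (fresh s t) s /\ term_bound (fresh s t) t.
Proof. destruct s, t; simpl; lia. Qed.

(** The pair itself is quantified over [V a], which contains it because [a] is a limit. *)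
Lemma sat_rel a s1 s2 s t T : limit a ->
  eval1 s1 s ∈ V a -> eval1 s1 t ∈ V a ->
  fo_sat a s1 s2 (rel s t T) <-> op (eval1 s1 s) (eval1 s1 t) ∈ eval2 s2 T.
Proof.
intros La Hs Ht; destruct (term_bound_fresh s t) as [Bs Bt].
unfold rel; rewrite sat_ex; split.
- intros [c [Hc H]]; rewrite sat_and, sat_is_op in H;
    rewrite ?(eval1_upd s1 c Bs), ?(eval1_upd s1 c Bt), ?upd_same in *; auto.
  cbn [fo_sat eval1] in H; rewrite upd_same in H; now destruct H as [<- H].
- intro H; exists (op (eval1 s1 s) (eval1 s1 t)).
  pose proof (V_op La Hs Ht); split; auto.
  rewrite sat_and, sat_is_op;
    rewrite ?(eval1_upd _ _ Bs), ?(eval1_upd _ _ Bt), ?upd_same; auto.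
  split; auto.
  cbn [fo_sat eval1]; now rewrite upd_same.
Qed.

Lemma fv1_rel s t T i :
  fo_fv1 (rel s t T) i -> term1_fv s i \/ term1_fv t i.
Proof. simpl; intuition congruence. Qed.

Lemma fv2_rel s t T i : fo_fv2 (rel s t T) i -> term2_fv T i.
Proof. simpl; tauto. Qed.

Lemma par1_rel s t T c : fo_par1 (rel s t T) c -> term1_par s c \/ term1_par t c.
Proof. simpl; tauto. Qed.

Lemma finite_fo_par2 p : finitely_many (fo_par2 p).
Proof.
induction p as [s t|s t|s [n|A]| |p [l1 H1] q [l2 H2]|n p [l H]]; simpl.
- exists nil; tauto.
- exists nil; tauto.
- exists nil; simpl; tauto.
- exists (A :: nil); simpl; intros; left; congruence.
- exists nil; tauto.
- exists (l1 ++ l2); intros A [H|H]; apply in_or_app; auto.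
- exists l; auto.
Qed.

Lemma fo_restr_self (k : U) p : fo_over k p -> fo_restr k p = p.
Proof.
intros [_ H]; induction p as [s t|s t|s [n|A]| |p IHp q IHq|n p IHp];
  simpl in *; auto.
- do 2 f_equal; apply mem_ext; intro z; rewrite mem_inter; split; [tauto|].
  intro Hz; split; auto; exact (H A eq_refl z Hz).
- f_equal; auto.
- f_equal; auto.
Qed.

Lemma fo_restr_par1 (a : U) p c : fo_par1 (fo_restr a p) c <-> fo_par1 p c.
Proof.
induction p as [s t|s t|s [n|A]| |p IHp q IHq|n p IHp]; simpl; tauto.
Qed.

Lemma fo_restr_fv2 (a : U) p n : fo_fv2 (fo_restr a p) n <-> fo_fv2 p n.
Proof.
induction p as [s t|s t|s [m|A]| |p IHp q IHq|m p IHp]; simpl; tauto.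
Qed.

Lemma fo_restr_par2 (a : U) p A :
  fo_par2 (fo_restr a p) A -> exists C, fo_par2 p C /\ A = inter C (V a).
Proof.
induction p as [s t|s t|s [m|C]| |p IHp q IHq|m p IHp]; simpl; try tauto.
- intros ->; eauto.
- intros [H|H]; [destruct (IHp H) as [C []]|destruct (IHq H) as [C []]]; eauto.
Qed.

Lemma fo_over_restr (k a : U) p :
  fo_over k p -> (forall c, fo_par1 p c -> c ∈ V a) -> fo_over a (fo_restr a p).
Proof.
intros Hp Hc; split.
- intros c Hc'; apply fo_restr_par1 in Hc'; auto.
- intros A HA; apply fo_restr_par2 in HA; destruct HA as [C [_ ->]].
  intros z Hz; now apply mem_inter in Hz.
Qed.

End FirstOrder.

(** * Levels of formulas, negation, and changes to first-order parts *)

Section Formulas.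
Context {U : zfc}.
Implicit Types (x y z a k : U).

(** The boolean is a polarity, [true] for Pi and [false] for Sigma; with it the single induction
    [lev_ind] replaces the mutual one. *)
Definition quant (s : bool) := if s then @All2 U else @Ex2 U.
Definition junct (s : bool) := if s then @Conj U else @Disj U.
Definition lev k (s : bool) x (p : formula U) :=
  if s then is_Pi k x p else is_Sigma k x p.

Scheme is_Pi_mut := Minimality for is_Pi Sort Prop
  with is_Sigma_mut := Minimality for is_Sigma Sort Prop.

Lemma lev_ind k (Q : bool -> U -> formula U -> Prop) :
  (forall s p, fo_over k p -> Q s empty (FO p)) ->
  (forall s x ns p, lev k (negb s) x p -> Q (negb s) x p ->
    Q s (succ x) (fold_right (quant s) p ns)) ->
  (forall s x p, limit x -> (forall z, z ∈ x -> lev k s z (p z)) ->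
    (forall z, z ∈ x -> Q s z (p z)) ->
    finitely_many (fv2 (junct s x p)) -> finitely_many (par2 (junct s x p)) ->
    Q s x (junct s x p)) ->
  forall s x p, lev k s x p -> Q s x p.
Proof.
intros H0 H1 H2 [] x p H.
- refine (is_Pi_mut (k := k) (P := Q true) (P0 := Q false) _ _ _ _ _ _ H); intros.
  + now apply H0.
  + now apply (H1 true).
  + now apply (H2 true).
  + now apply H0.
  + now apply (H1 false).
  + now apply (H2 false).
- refine (is_Sigma_mut (k := k) (P := Q true) (P0 := Q false) _ _ _ _ _ _ H); intros.
  + now apply H0.
  + now apply (H1 true).
  + now apply (H2 true).
  + now apply H0.
  + now apply (H1 false).
  + now apply (H2 false).
Qed.

Lemma lev_zero k s p : fo_over k p -> lev k s empty (FO p).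
Proof. destruct s; now constructor. Qed.

Lemma lev_succ k s x ns p :
  lev k (negb s) x p -> lev k s (succ x) (fold_right (quant s) p ns).
Proof. destruct s; now constructor. Qed.

Lemma lev_limit k s x p : limit x -> (forall z, z ∈ x -> lev k s z (p z)) ->
  finitely_many (fv2 (junct s x p)) -> finitely_many (par2 (junct s x p)) ->
  lev k s x (junct s x p).
Proof. destruct s; now constructor. Qed.

Lemma lev_zero_inv k s p :
  lev k s empty p -> exists q, p = FO q /\ fo_over k q.
Proof.
intro H; remember empty as x eqn:E; revert s x p H E.
refine (lev_ind _ _ _); intros; eauto.
- now apply succ_neq_empty in E.
- subst; apply limit_empty in H; now apply mem_empty in H.
Qed.

Lemma lev_succ_inv k s x p : lev k s (succ x) p ->
  exists ns q, p = fold_right (quant s) q ns /\ lev k (negb s) x q.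
Proof.
intro H; remember (succ x) as y eqn:E; revert s y p H E.
refine (lev_ind _ _ _).
- intros s p _ E; symmetry in E; now apply succ_neq_empty in E.
- intros s y ns p Hp _ E; apply succ_inj in E; subst; eauto.
- intros s y p Hy _ _ _ _ E; now apply limit_neq_succ in E.
Qed.

Lemma lev_limit_inv k s x p : limit x -> lev k s x p ->
  exists f, p = junct s x f /\ (forall z, z ∈ x -> lev k s z (f z)) /\
    finitely_many (fv2 p) /\ finitely_many (par2 p).
Proof.
intros Hx H; revert s x p H Hx.
refine (lev_ind _ _ _).
- intros s p _ H; apply limit_empty in H; now apply mem_empty in H.
- intros s y ns p _ _ H; destruct (limit_neq_succ H eq_refl).
- intros s x p _ H _ H1 H2 _; exists p; auto.
Qed.

Lemma par2_fold s p ns A : par2 (fold_right (quant s) p ns) A <-> par2 p A.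
Proof. induction ns; simpl; [|destruct s; simpl]; tauto. Qed.

Lemma fv2_fold s p ns i :
  fv2 (fold_right (quant s) p ns) i <-> ~ In i ns /\ fv2 p i.
Proof. induction ns; simpl; [|destruct s; simpl]; intuition. Qed.

Lemma fv1_junct s x (f : U -> formula U) i :
  fv1 (junct s x f) i <-> exists z, z ∈ x /\ fv1 (f z) i.
Proof. destruct s; simpl; tauto. Qed.

Lemma fv2_junct s x (f : U -> formula U) i :
  fv2 (junct s x f) i <-> exists z, z ∈ x /\ fv2 (f z) i.
Proof. destruct s; simpl; tauto. Qed.

Lemma par2_junct s x (f : U -> formula U) A :
  par2 (junct s x f) A <-> exists z, z ∈ x /\ par2 (f z) A.
Proof. destruct s; simpl; tauto. Qed.

Lemma finitely_many_sub (A : Type) (P Q : A -> Prop) :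
  (forall c, P c -> Q c) -> finitely_many Q -> finitely_many P.
Proof. intros H [l Hl]; exists l; auto. Qed.

Lemma finitely_many_or (A : Type) (P Q : A -> Prop) :
  finitely_many P -> finitely_many Q -> finitely_many (fun c => P c \/ Q c).
Proof.
intros [l Hl] [l' Hl']; exists (l ++ l'); intros c [H|H]; apply in_or_app; auto.
Qed.

Lemma finitely_many_le (m : nat) : finitely_many (fun n => n <= m).
Proof. exists (seq 0 (S m)); intros n H; apply in_seq; lia. Qed.

Lemma lev_finite_par2 k s x p : lev k s x p -> finitely_many (par2 p).
Proof.
revert s x p; refine (lev_ind _ _ _); auto.
- intros s p _; apply finite_fo_par2.
- intros s x ns p _; apply finitely_many_sub; intros A; apply par2_fold.
Qed.

(** A block of quantifiers ranges over the assignments that agree with [s2] off the block; in this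
    form repetitions in [ns] do no harm. *)
Lemma sat_fold_All2 a s1 s2 p ns : sat a s1 s2 (fold_right (@All2 U) p ns) <->
  forall t, (forall n, In n ns -> t n ⊆ V a) -> (forall n, ~ In n ns -> t n = s2 n) ->
    sat a s1 t p.
Proof.
revert s2; induction ns as [|n ns IH]; intro s2; simpl.
- split; [|intro H; apply H; tauto].
  intros H t _ Ht; replace t with s2; auto.
  apply functional_extensionality; intro n; symmetry; auto.
- split.
  + intros H t Ht Ht'; apply (proj1 (IH _) (H (t n) (Ht n (or_introl eq_refl))));
      auto.
    intros m Hm; destruct (Nat.eq_dec m n) as [->|E]; [now rewrite upd_same|].
    rewrite upd_other by auto; apply Ht'; intuition.
  + intros H X HX; apply IH; intros t Ht Ht'; apply H.
    * intros m Hm; destruct (classic (In m ns)) as [Hm'|Hm']; auto.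
      destruct Hm as [->|Hm]; [|contradiction].
      now rewrite (Ht' m Hm'), upd_same.
    * intros m Hm; rewrite Ht' by tauto; apply upd_other; intuition.
Qed.

Fixpoint neg (p : formula U) : formula U :=
  match p with
  | FO p => FO (fo_not p)
  | All2 n p => Ex2 n (neg p)
  | Ex2 n p => All2 n (neg p)
  | Conj x p => Disj x (fun z => neg (p z))
  | Disj x p => Conj x (fun z => neg (p z))
  end.

Lemma sat_neg a s1 s2 p : sat a s1 s2 (neg p) <-> ~ sat a s1 s2 p.
Proof.
revert s2; induction p as [p|n p IH|n p IH|x p IH|x p IH]; intro s2; simpl.
- tauto.
- split.
  + intros [X [HX H]] H'; apply IH in H; auto.
  + intro H; apply NNPP; intro H'; apply H; intros X HX; apply NNPP; intro H''.
    apply H'; exists X; now rewrite IH.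
- split.
  + intros H [X [HX H']]; revert H'; apply IH; auto.
  + intros H X HX; apply IH; intro H'; eauto.
- split.
  + intros [z [Hz H]] H'; apply IH in H; auto.
  + intro H; apply NNPP; intro H'; apply H; intros z Hz; apply NNPP; intro H''.
    apply H'; exists z; now rewrite IH.
- split.
  + intros H [z [Hz H']]; revert H'; apply IH; auto.
  + intros H z Hz; apply IH; intro H'; eauto.
Qed.

Lemma restr_neg b k a p : restr b k a (neg p) = neg (restr b k a p).
Proof.
induction p as [p|n p IH|n p IH|x p IH|x p IH]; simpl; try reflexivity; try congruence;
  match goal with |- context [excluded_middle_informative ?P] =>
    destruct (excluded_middle_informative P) end; simpl; f_equal;
  apply functional_extensionality; auto.
Qed.

Lemma fv1_neg p i : fv1 (neg p) i <-> fv1 p i.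
Proof.
induction p as [p|n p IH|n p IH|x p IH|x p IH]; simpl; try tauto;
  split; intros [z [Hz H]]; exists z; apply IH in H || rewrite IH; auto.
Qed.

Lemma fv2_neg p i : fv2 (neg p) i <-> fv2 p i.
Proof.
induction p as [p|n p IH|n p IH|x p IH|x p IH]; simpl; try tauto;
  split; intros [z [Hz H]]; exists z; apply IH in H || rewrite IH; auto.
Qed.

Lemma par2_neg p A : par2 (neg p) A <-> par2 p A.
Proof.
induction p as [p|n p IH|n p IH|x p IH|x p IH]; simpl; try tauto;
  split; intros [z [Hz H]]; exists z; apply IH in H || rewrite IH; auto.
Qed.

Lemma neg_fold s p ns :
  neg (fold_right (quant s) p ns) = fold_right (quant (negb s)) (neg p) ns.
Proof. destruct s; induction ns; simpl in *; congruence. Qed.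

Lemma lev_neg k s x p : lev k s x p -> lev k (negb s) x (neg p).
Proof.
revert s x p; refine (lev_ind _ _ _).
- intros s p [H1 H2]; apply lev_zero; split; simpl; intuition.
- intros s x ns p _ IH; rewrite neg_fold; now apply lev_succ.
- intros s x p Hx _ IH H1 H2.
  replace (neg (junct s x p)) with (junct (negb s) x (fun z => neg (p z)))
    by now destruct s.
  apply lev_limit; auto.
  + revert H1; apply finitely_many_sub; intros i; rewrite !fv2_junct.
    intros [z [Hz H]]; exists z; now rewrite fv2_neg in H.
  + revert H2; apply finitely_many_sub; intros A; rewrite !par2_junct.
    intros [z [Hz H]]; exists z; now rewrite par2_neg in H.
Qed.

(** Only the first-order leaves change, so blocks and junctions keep their levels. This serves to
    conjoin a first-order sentence to a formula of any level, and to recode second-order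
    parameters. *)
Fixpoint map_fo (g : fo U -> fo U) (p : formula U) : formula U :=
  match p with
  | FO p => FO (g p)
  | All2 n p => All2 n (map_fo g p)
  | Ex2 n p => Ex2 n (map_fo g p)
  | Conj x p => Conj x (fun z => map_fo g (p z))
  | Disj x p => Disj x (fun z => map_fo g (p z))
  end.

Lemma map_fo_fold g s p ns :
  map_fo g (fold_right (quant s) p ns) = fold_right (quant s) (map_fo g p) ns.
Proof. destruct s; induction ns; simpl in *; congruence. Qed.

Lemma map_fo_junct g s x (f : U -> formula U) :
  map_fo g (junct s x f) = junct s x (fun z => map_fo g (f z)).
Proof. now destruct s. Qed.

Lemma map_fo_fv1 g p i : (forall q, fo_fv1 (g q) i -> fo_fv1 q i) ->
  fv1 (map_fo g p) i -> fv1 p i.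
Proof.
intro Hg; induction p as [p|n p IH|n p IH|x p IH|x p IH]; simpl; auto;
  intros [z [Hz H]]; eauto.
Qed.

Lemma map_fo_fv2 g p i : (forall q, fo_fv2 (g q) i -> fo_fv2 q i) ->
  fv2 (map_fo g p) i -> fv2 p i.
Proof.
intro Hg; induction p as [p|n p IH|n p IH|x p IH|x p IH]; simpl; auto;
  try tauto; intros [z [Hz H]]; eauto.
Qed.

Lemma map_fo_par2 g p (P : U -> Prop) :
  (forall q A, fo_par2 (g q) A -> fo_par2 q A \/ P A) ->
  forall A, par2 (map_fo g p) A -> par2 p A \/ P A.
Proof.
intros Hg A; induction p as [p|n p IH|n p IH|x p IH|x p IH]; simpl; auto;
  intros [z [Hz H]]; destruct (IH z H); eauto.
Qed.

(** The third hypothesis bounds the new parameters uniformly in [q]: infinitely many leaves may be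
    changed, yet a junction may have only finitely many second-order parameters. *)
Lemma lev_map_fo k g s x p :
  (forall q, fo_over k q -> fo_over k (g q)) ->
  (forall q i, fo_fv2 (g q) i -> fo_fv2 q i) ->
  finitely_many (fun A => exists q, fo_par2 (g q) A /\ ~ fo_par2 q A) ->
  lev k s x p -> lev k s x (map_fo g p).
Proof.
intros H0 H1 H2; revert s x p; refine (lev_ind _ _ _).
- intros s p Hp; apply lev_zero; auto.
- intros s x ns p _ IH; rewrite map_fo_fold; now apply lev_succ.
- intros s x p Hx _ IH H3 H4; rewrite map_fo_junct; apply lev_limit; auto.
  + revert H3; apply finitely_many_sub; intros i; rewrite <- map_fo_junct.
    apply map_fo_fv2; auto.
  + refine (finitely_many_sub _ (finitely_many_or H4 H2)); intros A.
    rewrite <- map_fo_junct; revert A.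
    apply (map_fo_par2 (P := fun A => exists q, fo_par2 (g q) A /\ ~ fo_par2 q A)).
    intros q C HC; destruct (classic (fo_par2 q C)); eauto.
Qed.

(** Since a valid formula cannot be lifted through the infinite levels, one is built at each level.
    It is the instance given to indescribability when only the reflection point matters. *)
Lemma lev_true k s x : ordinal x -> exists p, lev k s x p /\
  (forall i, ~ fv1 p i) /\ (forall i, ~ fv2 p i) /\ (forall A, ~ par2 p A) /\
  forall a s1 s2, sat a s1 s2 p.
Proof.
revert s; induction x as [x IH] using (well_founded_ind (@mem_wf U)); intros s Ox.
destruct (ordinal_cases Ox) as [->|[[y [Oy ->]]|Lx]].
- exists (FO (fo_not (Bot U))); split; [apply lev_zero; split|]; simpl; tauto.
- destruct (IH y (mem_succ_self y) (negb s) Oy) as [p [H1 [H2 [H3 [H4 H5]]]]].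
  exists p; split; auto; exact (lev_succ nil H1).
- destruct (mem_choice (x := x) (A := formula U) (R := fun z p => lev k s z p /\
    (forall i, ~ fv1 p i) /\ (forall i, ~ fv2 p i) /\ (forall A, ~ par2 p A) /\
    forall a s1 s2, sat a s1 s2 p)) as [f Hf].
  + exact (inhabits (FO (Bot U))).
  + intros z Hz; apply IH; auto; exact (ordinal_mem Ox Hz).
  + assert (H2 : forall i, ~ fv2 (junct s x f) i).
    { intros i H; apply fv2_junct in H; destruct H as [z [Hz H]].
      now apply (Hf z Hz) in H. }
    assert (H3 : forall A, ~ par2 (junct s x f) A).
    { intros A H; apply par2_junct in H; destruct H as [z [Hz H]].
      now apply (Hf z Hz) in H. }
    exists (junct s x f); split; [|split; [|split; [|split]]]; auto.
    * apply lev_limit; auto.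
      -- intros z Hz; apply Hf; auto.
      -- exists nil; intros i H; now apply H2 in H.
      -- exists nil; intros i H; now apply H3 in H.
    * intros i H; apply fv1_junct in H; destruct H as [z [Hz H]].
      now apply (Hf z Hz) in H.
    * pose proof (limit_empty Lx) as He.
      destruct s; simpl; [intros; apply Hf; auto|].
      exists empty; split; auto; apply Hf; auto.
Qed.

End Formulas.

(** * Reflection of closure properties *)

Section Reflection.
Context {U : zfc}.
Implicit Types (x y z a k : U) (chi : fo U).

Definition noval : nat -> U := fun _ => empty.

Definition and_fo chi : formula U -> formula U := map_fo (fun q => fo_and q chi).

Lemma sat_map_fo a s1 s2 g p :
  (forall q s2, fo_sat a s1 s2 q -> fo_sat a s1 s2 (g q)) ->
  sat a s1 s2 p -> sat a s1 s2 (map_fo g p).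
Proof.
intro Hg; revert s2; induction p as [p|n p IH|n p IH|x p IH|x p IH]; intro s2;
  simpl; auto.
- intros [X [HX H]]; eauto.
- intros [z [Hz H]]; eauto.
Qed.

Lemma sat_restr_map_fo b k a s1 s2 g p :
  (forall q s2, fo_sat a s1 s2 (fo_restr a (g q)) ->
     fo_sat a s1 s2 (fo_restr a q)) ->
  sat a s1 s2 (restr b k a (map_fo g p)) -> sat a s1 s2 (restr b k a p).
Proof.
intro Hg; revert s2; induction p as [p|n p IH|n p IH|x p IH|x p IH]; intro s2;
  simpl; auto.
- intros [X [HX H]]; eauto.
- match goal with |- context [excluded_middle_informative ?P] =>
    destruct (excluded_middle_informative P) end; simpl; auto.
- match goal with |- context [excluded_middle_informative ?P] =>
    destruct (excluded_middle_informative P) end; simpl;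
    intros [z [Hz H]]; eauto.
Qed.

Lemma restr_fold b k a s p ns :
  restr b k a (fold_right (quant s) p ns) =
  fold_right (quant s) (restr b k a p) ns.
Proof. destruct s; induction ns; simpl in *; congruence. Qed.

Lemma restr_defined_fold b k a s p ns :
  restr_defined b k a (fold_right (quant s) p ns) <-> restr_defined b k a p.
Proof. destruct s; induction ns; simpl in *; tauto. Qed.

Lemma restr_defined_junct b k a s x f : restr_defined b k a (junct s x f) <->
  x ∈ k \/ regular k /\ forall z, z ∈ canf b k x a ->
    restr_defined b k a (f (canpi_inv b k x a z)) /\
    lev a s z (restr b k a (f (canpi_inv b k x a z))).
Proof. now destruct s. Qed.

Lemma restr_junct_small b k a s x f : x ∈ k ->
  restr b k a (junct s x f) = junct s x (fun z => restr b k a (f z)).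
Proof.
intro H; destruct s; simpl;
  now destruct (excluded_middle_informative (x ∈ k)).
Qed.

Lemma restr_junct_large b k a s x f : x ∉ k ->
  restr b k a (junct s x f) =
  junct s (canf b k x a) (fun z => restr b k a (f (canpi_inv b k x a z))).
Proof.
intro H; destruct s; simpl;
  now destruct (excluded_middle_informative (x ∈ k)).
Qed.

Lemma canF_small b k x a : x ∈ k -> canF b k x a = x.
Proof.
intro H; unfold canF; now destruct (excluded_middle_informative (x ∈ k)).
Qed.

Lemma canF_large b k x a : x ∉ k -> canF b k x a = image (b k x) a.
Proof.
intro H; unfold canF; now destruct (excluded_middle_informative (x ∈ k)).
Qed.

Lemma ordinal_card_succ k kp : card_succ k kp -> ordinal kp.
Proof. intro H; apply H. Qed.

Lemma ordinal_card k kp : card_succ k kp -> ordinal k.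
Proof. intros [[H _] [Hk _]]; exact (ordinal_mem H Hk). Qed.

Lemma canF_subset b k kp x a : canonical_bijections b -> card_succ k kp ->
  regular k -> x ∈ kp -> a ⊆ k -> canF b k x a ⊆ x.
Proof.
intros Hb Hkp Hk Hx Ha; destruct (classic (x ∈ k)) as [H|H].
- rewrite canF_small by auto; now intro.
- rewrite canF_large by auto; intros z Hz; apply mem_image in Hz.
  destruct Hz as [c [Hc ->]].
  apply (proj1 (Hb k Hk) kp x Hkp Hx); auto.
  apply ordinal_not_mem; auto; [apply Hk|].
  exact (ordinal_mem (ordinal_card_succ Hkp) Hx).
Qed.

Lemma canf_nonempty b k x a : a <> empty -> x ∉ k -> exists z, z ∈ canf b k x a.
Proof.
intros Ha Hx; destruct (empty_or_inhabited a) as [->|[c Hc]]; [now destruct Ha|].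
unfold canf; rewrite canF_large by auto.
exists (collapse (image (b k x) a) (b k x c)); apply mem_ot.
exists (b k x c); rewrite mem_image; eauto.
Qed.

(** Some leaf gets evaluated: a true disjunction or existential formula supplies one, and a
    restricted conjunction keeps a conjunct because [a] is nonempty. Regularity of [k] is yet to be
    derived from such reflection; at levels from [k] on it is read off from [restr_defined]. *)
Lemma sat_restr_and_fo b k kp a s1 s2 chi s x p :
  canonical_bijections b -> card_succ k kp -> a <> empty -> a ⊆ k ->
  x ∈ kp -> lev k s x p ->
  restr_defined b k a (and_fo chi p) -> sat a s1 s2 (restr b k a (and_fo chi p)) ->
  exists t, fo_sat a s1 t (fo_restr a chi).
Proof.
(* For a junction of level below [k], [restr_defined] says nothing about the subformulas; weakened
   by [x ∈ k], the hypothesis passes to them. *)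
intros Hb Hkp Ha Hak Hx Hp Hd; apply (@or_intror (x ∈ k)) in Hd.
assert (Okp := ordinal_card_succ Hkp).
assert (Ok : ordinal k) by (exact (ordinal_card Hkp)).
revert s2; revert s x p Hp Hx Hd; unfold and_fo.
refine (lev_ind _ _ _).
- intros s p _ _ _ s2 H; simpl in H; exists s2; apply NNPP; tauto.
- intros s x ns p _ IH Hx Hd s2.
  rewrite map_fo_fold, restr_defined_fold in Hd.
  rewrite map_fo_fold, restr_fold; revert s2.
  assert (Hx' : x ∈ kp) by exact (ordinal_trans Okp (mem_succ_self x) Hx).
  assert (Hd' : x ∈ k \/ restr_defined b k a (map_fo (fun q => fo_and q chi) p)).
  { destruct Hd as [Hd|Hd]; auto; left.
    exact (ordinal_trans Ok (mem_succ_self x) Hd). }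
  induction ns as [|n ns IHn]; intro s2; simpl; [now apply IH|].
  destruct s; simpl.
  + intro H; apply (IHn (upd s2 n empty)), H; intros z Hz; now apply mem_empty in Hz.
  + intros [X [HX H]]; exact (IHn _ H).
- intros s x p Lx _ IH _ _ Hx Hd s2.
  rewrite map_fo_junct, restr_defined_junct in Hd; rewrite map_fo_junct.
  assert (Hz' : forall z, z ∈ x -> z ∈ kp).
  { intros z Hz; exact (ordinal_trans Okp Hz Hx). }
  destruct (classic (x ∈ k)) as [Hk|Hk].
  + rewrite restr_junct_small by auto.
    assert (Hzk : forall z, z ∈ x -> z ∈ k).
    { intros z Hz; exact (ordinal_trans Ok Hz Hk). }
    destruct s; simpl; intro H.
    * pose proof (limit_empty Lx) as He; apply (IH _ He (Hz' _ He)) with s2; auto.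
    * destruct H as [z [Hz H]]; apply (IH z Hz) with s2; auto.
  + destruct Hd as [Hd|[Hd|[Hr Hd]]]; [contradiction|contradiction|].
    rewrite restr_junct_large by auto.
    assert (Hc : forall z, z ∈ canf b k x a -> canpi_inv b k x a z ∈ x).
    { intros z Hz; pose proof (canF_subset Hb Hkp Hr Hx Hak) as HF.
      apply HF; exact (proj1 (collapse_invP (proj1 Lx) HF Hz)). }
    destruct s; simpl; intro H.
    * destruct (canf_nonempty b Ha Hk) as [z Hz].
      apply (IH _ (Hc z Hz) (Hz' _ (Hc z Hz))) with s2; auto; right; now apply Hd.
    * destruct H as [z [Hz H]].
      apply (IH _ (Hc z Hz) (Hz' _ (Hc z Hz))) with s2; auto; right; now apply Hd.
Qed.

Lemma sentence_and_fo chi p :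
  (forall i, ~ fo_fv1 chi i) -> (forall i, ~ fo_fv2 chi i) ->
  sentence p -> sentence (and_fo chi p).
Proof.
intros H1 H2 [H3 H4]; split; intros i H.
- apply (H3 i); revert H; apply map_fo_fv1; intro q; simpl; specialize (H1 i); tauto.
- apply (H4 i); revert H; apply map_fo_fv2; intro q; simpl; specialize (H2 i); tauto.
Qed.

Lemma lev_and_fo k s x chi p : fo_over k chi -> (forall i, ~ fo_fv2 chi i) ->
  lev k s x p -> lev k s x (and_fo chi p).
Proof.
intros [H1 H2] H3; apply lev_map_fo.
- intros q [H4 H5]; split; simpl; intuition.
- intros q i; simpl; specialize (H3 i); tauto.
- refine (finitely_many_sub _ (finite_fo_par2 chi)); intros A [q H]; simpl in H; tauto.
Qed.

(** Leaves occur only positively, so [chi] can be conjoined to all leaves of [p] without changing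
    truth in [V k], and dropped again after reflection. *)
Lemma indescribable_reflects_fo b k kp xi S chi p :
  canonical_bijections b -> card_succ k kp -> xi ∈ kp ->
  indescribable b k xi S -> is_Pi k xi p -> sentence p -> models k p ->
  fo_over k chi -> (forall i, ~ fo_fv1 chi i) -> (forall i, ~ fo_fv2 chi i) ->
  (forall t, fo_sat k noval t chi) ->
  exists a, a ∈ S /\ a ∈ k /\ regular a /\ models a (restr b k a p) /\
    exists t, fo_sat a noval t (fo_restr a chi).
Proof.
intros Hb Hkp Hxi HS Hp Sp Mp Hc H1 H2 Mc.
destruct (HS (and_fo chi p)) as [a [HaS [Hak [Ra [Hd [_ Ha]]]]]].
- exact (lev_and_fo (s := true) Hc H2 Hp).
- now apply sentence_and_fo.
- revert Mp; apply sat_map_fo; intros q s2 Hq; now apply sat_and.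
- exists a; refine (conj HaS (conj Hak (conj Ra (conj _ _)))).
  + revert Ha; apply sat_restr_map_fo; intros q s2 Hq; apply NNPP; simpl in Hq; tauto.
  + refine (sat_restr_and_fo (s := true) Hb Hkp _ _ Hxi Hp Hd Ha).
    * intros ->; pose proof (limit_empty (regular_limit Ra)) as H.
      now apply mem_empty in H.
    * intros z Hz; apply (ordinal_trans (y := a)); auto.
      exact (ordinal_card Hkp).
Qed.

(** If [A] is the graph of a function [h], restriction replaces [A] by [inter A (V a)], and the
    restricted sentence says that [V a] is closed under [h]. *)
Definition closure_fo (A : U) : fo U :=
  All1 0 (fo_ex 1 (rel (Var1 0) (Var1 1) (Par2 A))).

Lemma sat_closure_fo a s1 s2 A : limit a -> fo_sat a s1 s2 (closure_fo A) <->
  forall c, c ∈ V a -> exists d, d ∈ V a /\ op c d ∈ A.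
Proof.
intro La; unfold closure_fo; cbn [fo_sat].
split; intros H c Hc; specialize (H c Hc); [rewrite sat_ex in H|rewrite sat_ex];
  destruct H as [d [Hd H]]; exists d; split; auto; revert H; rewrite sat_rel; auto.
Qed.

Definition closed (h : U -> U) a : Prop := forall c, c ∈ V a -> h c ∈ V a.

Lemma indescribable_limit b k kp xi S :
  canonical_bijections b -> card_succ k kp -> xi ∈ kp ->
  indescribable b k xi S -> limit k.
Proof.
intros Hb Hkp Hxi HS; assert (Okp := ordinal_card_succ Hkp).
assert (Ok : ordinal k) by (exact (ordinal_card Hkp)).
destruct (lev_true k true (ordinal_mem Okp Hxi)) as [p [H1 [H2 [H3 [_ H4]]]]].
destruct (ordinal_cases Ok) as [->|[[c [Oc ->]]|Lk]]; auto; exfalso.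
- destruct (HS p) as [a [_ [Ha _]]]; auto; [now split|apply H4|].
  now apply mem_empty in Ha.
(* That the parameter with sole element [c] is nonempty reflects to an [a] with [c ∈ V a], hence
   [c ∈ a], which is impossible for [a ∈ succ c]. *)
- assert (Hc : c ∈ V (succ c)) by (apply subset_V, mem_succ_self).
  destruct (indescribable_reflects_fo
    (chi := fo_ex 0 (In2 (Var1 0) (Par2 (pair c c)))) Hb Hkp Hxi HS H1)
    as [a [_ [Ha [Ra [_ [t Ht]]]]]].
  + now split.
  + apply H4.
  + split; simpl; try tauto; intros A [[->|[]]|[]] z Hz.
    apply mem_pair in Hz; destruct Hz as [->| ->]; auto.
  + simpl; tauto.
  + simpl; tauto.
  + intro t; rewrite sat_ex; exists c; split; auto; simpl; apply mem_pair; auto.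
  + change (fo_sat a noval t (fo_ex 0 (In2 (Var1 0) (Par2 (inter (pair c c) (V a))))))
      in Ht.
    rewrite sat_ex in Ht; destruct Ht as [d [Hd Ht]]; simpl in Ht.
    assert (Oa := proj1 (regular_limit Ra)).
    rewrite mem_inter, mem_pair in Ht; destruct Ht as [Ht _].
    assert (E : d = c) by tauto; rewrite E in Hd.
    apply ordinal_mem_V in Hd; auto.
    apply mem_succ in Ha; destruct Ha as [Ha| ->].
    * destruct (mem_asym Ha Hd).
    * destruct (mem_irrefl Hd).
Qed.

Lemma indescribable_reflects_closed b k kp xi S h p :
  canonical_bijections b -> card_succ k kp -> xi ∈ kp ->
  indescribable b k xi S -> is_Pi k xi p -> sentence p -> models k p ->
  closed h k ->
  exists a, a ∈ S /\ a ∈ k /\ regular a /\ models a (restr b k a p) /\ closed h a.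
Proof.
intros Hb Hkp Hxi HS Hp Sp Mp Hh.
assert (Lk := indescribable_limit Hb Hkp Hxi HS).
set (A := image (fun c => op c (h c)) (V k)).
destruct (indescribable_reflects_fo (chi := closure_fo A) Hb Hkp Hxi HS Hp)
  as [a [H1 [H2 [H3 [H4 [t Ht]]]]]]; auto.
- split; simpl; try tauto; intros B HB.
  assert (B = A) as -> by tauto; intros z Hz; apply mem_image in Hz.
  destruct Hz as [c [Hc ->]]; apply V_op; auto.
- intro i; simpl; lia.
- simpl; tauto.
- intro t; apply sat_closure_fo; auto; intros c Hc; exists (h c); split; auto.
  apply mem_image; eauto.
- exists a; refine (conj H1 (conj H2 (conj H3 (conj H4 _)))); intros c Hc.
  assert (Ht' := proj1 (sat_closure_fo noval t (inter A (V a)) (regular_limit H3)) Ht).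
  destruct (Ht' c Hc) as [d [Hd H]]; apply mem_inter in H; destruct H as [H _].
  apply mem_image in H; destruct H as [c' [_ E]]; apply op_inj in E.
  now destruct E as [<- <-].
Qed.

Lemma indescribable_regular b k kp xi S :
  canonical_bijections b -> cardinal k -> card_succ k kp -> xi ∈ kp ->
  indescribable b k xi S -> regular k.
Proof.
intros Hb Ck Hkp Hxi HS; assert (Okp := ordinal_card_succ Hkp).
assert (Lk := indescribable_limit Hb Hkp Hxi HS).
assert (Ok := proj1 Lk).
destruct (lev_true k true (ordinal_mem Okp Hxi)) as [p [H1 [H2 [H3 [_ H4]]]]].
assert (reflects : forall h, closed h k -> exists a, a ∈ k /\ regular a /\ closed h a).
{ intros h Hh.
  destruct (indescribable_reflects_closed Hb Hkp Hxi HS H1 (conj H2 H3)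
    (H4 k noval noval) Hh) as [a [_ [H5 [H6 [_ H7]]]]]; eauto. }
split; [auto|split].
- destruct (reflects (fun c => c)) as [a [Ha [Ra _]]]; [now intro|].
  intros z Hz; apply (ordinal_trans Ok (y := a)); auto; now apply Ra.
- intros a f Ha Hf.
  (* Pairing each value with the constant [a] makes one closure condition yield both [a ∈ d] and
     [f c ∈ d]; regularity of [d] then bounds [f] on [a]. *)
  destruct (reflects (fun c => op a (if excluded_middle_informative (c ∈ a)
    then f c else empty))) as [d [Hd [Rd H]]].
  + intros c Hc; apply V_op; auto; [now apply subset_V|].
    destruct (excluded_middle_informative (c ∈ a)); [|now apply V_empty].
    apply subset_V; auto.
  + assert (Ld := regular_limit Rd); assert (Od := proj1 Ld).
    assert (Had : a ∈ d).
    { apply ordinal_mem_V; auto; [exact (ordinal_mem Ok Ha)|].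
      exact (proj1 (V_op_inv Od (H _ (V_empty Ld)))). }
    destruct (proj2 (proj2 Rd) a f Had) as [e [He He']].
    * intros c Hc; apply ordinal_mem_V; auto.
      -- exact (ordinal_mem Ok (Hf c Hc)).
      -- assert (Hcd : c ∈ V d).
         { apply subset_V; exact (ordinal_trans Od Hc Had). }
         apply H in Hcd; apply V_op_inv in Hcd; auto; destruct Hcd as [_ Hcd].
         now destruct (excluded_middle_informative (c ∈ a)).
    * exists e; split; auto; exact (ordinal_trans Ok He Hd).
Qed.

End Reflection.

(** * Canonical functions and restrictions *)

Section Large.
Context {U : zfc} (b : U -> U -> U -> U) (k kp : U)
  (Hb : canonical_bijections b) (Hkp : card_succ k kp) (Rk : regular k).
Implicit Types (x y z w a c i : U) (P Q : U -> Prop).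

Definition upto a : Prop := a ∈ k \/ a = k.

(* The value [a = k] is included so that a property which is [large] holds in
   particular at [k] itself. *)
Definition large P : Prop :=
  exists h, closed h k /\ forall a, upto a -> regular a -> closed h a -> P a.

Lemma upto_subset a : upto a -> a ⊆ k.
Proof.
intros [Ha| ->] z Hz; auto; exact (ordinal_trans (ordinal_card Hkp) Hz Ha).
Qed.

Lemma upto_V a : upto a -> V a ⊆ V k.
Proof. intro H; now apply V_mono, upto_subset. Qed.

Lemma large_k P : large P -> P k.
Proof. intros [h [Hh H]]; apply H; auto; now right. Qed.

Lemma large_intro P : (forall a, upto a -> regular a -> P a) -> large P.
Proof. intro H; exists (fun c => c); split; auto; now intro. Qed.

Lemma large_mono P Q :
  (forall a, upto a -> regular a -> P a -> Q a) -> large P -> large Q.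
Proof. intros H [h [Hh HP]]; exists h; auto. Qed.

(** Since [V a] is transitive, closure under the paired function gives closure under both
    components. *)
Lemma large_and P Q : large P -> large Q -> large (fun a => P a /\ Q a).
Proof.
intros [g [Hg HP]] [h [Hh HQ]]; exists (fun c => op (g c) (h c)); split.
- intros c Hc; apply V_op; auto; now apply regular_limit.
- intros a Ha Ra H; assert (Oa := proj1 (regular_limit Ra)); split.
  + apply HP; auto; intros c Hc; exact (proj1 (V_op_inv Oa (H c Hc))).
  + apply HQ; auto; intros c Hc; exact (proj2 (V_op_inv Oa (H c Hc))).
Qed.

Lemma large_mem c : c ∈ V k -> large (fun a => c ∈ V a).
Proof.
intro Hc; exists (fun _ => c); split; [now intros d _|].
intros a _ Ra H; apply (H empty), V_empty; now apply regular_limit.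
Qed.

(** Uncurrying on ordered pairs; the default [empty] elsewhere keeps [V k] closed under [h]. *)
Lemma op_fun (H : U -> U -> U) : exists h : U -> U,
  (forall i c, h (op i c) = H i c) /\
  forall w, h w = empty \/ exists i c, w = op i c /\ h w = H i c.
Proof.
set (R w v := (exists i c, w = op i c /\ v = H i c) \/
    (~ exists i c, w = op i c) /\ v = empty).
assert (Hh : forall w, R w (epsilon (inhabits empty) (R w))).
{ intro w; apply epsilon_spec.
  destruct (classic (exists i c, w = op i c)) as [[i [c E]]|E].
  - exists (H i c); left; eauto.
  - exists empty; now right. }
exists (fun w => epsilon (inhabits empty) (R w)); split.
- intros i c; destruct (Hh (op i c)) as [[j [d [E ->]]]|[E _]].
  + apply op_inj in E; now destruct E as [-> ->].
  + destruct E; eauto.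
- intro w; destruct (Hh w) as [H'|[_ H']]; auto.
Qed.

(** Diagonal intersection: the functions witnessing [large (P i)] become one function on pairs
    [op i c], and closure of [V a] under it serves all indices [i ∈ V a] at once. *)
Lemma large_diag (P : U -> U -> Prop) : (forall i, i ∈ V k -> large (P i)) ->
  large (fun a => forall i, i ∈ V a -> P i a).
Proof.
intro HP; apply mem_choice in HP; [|exact (inhabits (fun c => c))].
destruct HP as [H HP]; destruct (op_fun H) as [h [h1 h2]].
assert (Lk := regular_limit Rk); exists h; split.
- intros w Hw; destruct (h2 w) as [->|[i [c [E ->]]]]; [now apply V_empty|].
  subst; apply V_op_inv in Hw; [|apply Lk]; destruct Hw as [Hi Hc].
  now apply HP.
- intros a Ha Ra Hh i Hi; apply HP; auto; [now apply upto_V with a|].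
  intros c Hc; rewrite <- h1; apply Hh, V_op; auto; now apply regular_limit.
Qed.

Lemma ordinal_below x : x ∈ kp -> ordinal x.
Proof. intro Hx; exact (ordinal_mem (ordinal_card_succ Hkp) Hx). Qed.

Lemma below_trans x z : x ∈ kp -> z ∈ x -> z ∈ kp.
Proof. intros Hx Hz; exact (ordinal_trans (ordinal_card_succ Hkp) Hz Hx). Qed.

Lemma canonical_bijection x : x ∈ kp -> x ∉ k -> bijection (b k x) k x.
Proof.
intros Hx H; apply (proj1 (Hb Rk) kp); auto.
apply ordinal_not_mem; auto; [exact (ordinal_card Hkp)|now apply ordinal_below].
Qed.

Lemma mem_canF x a z : upto a -> x ∈ kp -> z ∈ canF b k x a -> z ∈ x.
Proof.
intros Ha Hx; apply (canF_subset Hb Hkp Rk Hx); now apply upto_subset.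
Qed.

Lemma large_canF_mem x z : x ∈ kp -> z ∈ x -> large (fun a => z ∈ canF b k x a).
Proof.
intros Hx Hz; destruct (classic (x ∈ k)) as [Hk|Hk].
- apply large_intro; intros; now rewrite canF_small.
- destruct (canonical_bijection Hx Hk) as [_ [_ H]].
  destruct (H z Hz) as [i [Hi <-]].
  refine (large_mono _ (large_mem (subset_V Hi))).
  intros a Ha Ra H'; rewrite canF_large by auto; apply mem_image; exists i.
  split; auto; apply ordinal_mem_V; auto; [apply regular_limit in Ra; apply Ra|].
  exact (ordinal_mem (ordinal_card Hkp) Hi).
Qed.

(** For [x] at least [k], the set [canF b k x a] is the part of [x] enumerated before [a], so a
    diagonal intersection over [V a] covers it. For [x ∈ k] the index set is all of [x], and [x]
    lies in [V a] for large [a]. *)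
Lemma large_canF_diag x (P : U -> U -> Prop) : x ∈ kp ->
  (forall z, z ∈ x -> large (P z)) ->
  large (fun a => forall z, z ∈ canF b k x a -> P z a).
Proof.
intros Hx HP; destruct (classic (x ∈ k)) as [Hk|Hk].
- assert (H : large (fun a => x ∈ V a /\ forall i, i ∈ V a -> i ∈ x -> P i a)).
  { apply large_and; [now apply large_mem, subset_V|].
    apply large_diag; intros i _; destruct (classic (i ∈ x)).
    - refine (large_mono _ (HP i H)); auto.
    - apply large_intro; contradiction. }
  refine (large_mono _ H); intros a Ha Ra [H1 H2] z; rewrite canF_small by auto.
  intro Hz; apply H2; auto; apply V_trans with x; auto.
  apply regular_limit in Ra; apply Ra.
- destruct (canonical_bijection Hx Hk) as [Hbk _].
  assert (H : large (fun a => forall i, i ∈ V a -> i ∈ k -> P (b k x i) a)).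
  { apply large_diag; intros i _; destruct (classic (i ∈ k)).
    - refine (large_mono _ (HP _ (Hbk i H))); auto.
    - apply large_intro; contradiction. }
  refine (large_mono _ H); intros a Ha Ra H' z; rewrite canF_large by auto.
  intro Hz; apply mem_image in Hz; destruct Hz as [i [Hi ->]].
  apply H'; [now apply subset_V|now apply upto_subset in Hi].
Qed.

(** Each inclusion is a diagonal intersection, along one of the two sets, of instances of
    [large_canF_mem] for the other. *)
Lemma large_canF_coherent x z : x ∈ kp -> z ∈ x ->
  large (fun a => canF b k z a = inter (canF b k x a) z).
Proof.
intros Hx Hz; assert (Hz' := below_trans Hx Hz).
assert (H1 : large (fun a => forall w, w ∈ canF b k z a -> w ∈ canF b k x a)).
{ apply large_canF_diag; auto; intros w Hw; apply large_canF_mem; auto.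
  exact (ordinal_trans (ordinal_below Hx) Hw Hz). }
assert (H2 : large (fun a => forall w, w ∈ canF b k x a -> w ∈ z ->
  w ∈ canF b k z a)).
{ apply large_canF_diag; auto; intros w _; destruct (classic (w ∈ z)).
  - refine (large_mono _ (large_canF_mem Hz' H)); auto.
  - apply large_intro; contradiction. }
refine (large_mono _ (large_and H1 H2)); intros a Ha Ra [H3 H4].
apply mem_ext; intro w; rewrite mem_inter; split.
- intro Hw; split; auto; exact (mem_canF Ha Hz' Hw).
- intros [H5 H6]; auto.
Qed.

(** So the level which the restriction gives to the conjunct at [z] is also its position in the
    restricted junction; this is what makes restrictions defined. *)
Lemma large_canf_collapse x z : x ∈ kp -> z ∈ x ->
  large (fun a => canf b k z a = collapse (canF b k x a) z).
Proof.
intros Hx Hz; refine (large_mono _ (large_canF_coherent Hx Hz)).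
intros a Ha Ra H; unfold canf; rewrite H, collapse_ot; auto.
exact (ordinal_below (below_trans Hx Hz)).
Qed.

Lemma collapse_succ F z : z ∈ F -> collapse F (succ z) = succ (collapse F z).
Proof.
intro Hz; apply mem_ext; intro w; rewrite mem_succ, !mem_collapse; split.
- intros [y [H1 [H2 ->]]]; apply mem_succ in H1; destruct H1 as [H1| ->]; eauto.
- intros [[y [H1 [H2 ->]]]| ->]; [exists y|exists z]; rewrite mem_succ; auto.
Qed.

Lemma collapse_top F x : F ⊆ x -> collapse F x = ot F.
Proof.
intro HF; apply mem_ext; intro w; rewrite mem_collapse, mem_ot; split.
- intros [z [_ H]]; eauto.
- intros [z [H1 H2]]; eauto.
Qed.

Lemma canf_empty a : canf b k empty a = empty.
Proof.
unfold canf; rewrite canF_small by (now apply limit_empty, regular_limit).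
apply ot_ordinal, ordinal_empty.
Qed.

Lemma large_canf_succ x : succ x ∈ kp ->
  large (fun a => canf b k (succ x) a = succ (canf b k x a)).
Proof.
intro Hx; assert (H := mem_succ_self x).
refine (large_mono _ (large_and (large_canf_collapse Hx H) (large_canF_mem Hx H))).
intros a Ha Ra [H1 H2]; rewrite H1, <- collapse_succ by auto.
unfold canf; rewrite collapse_top; auto; intros z Hz; exact (mem_canF Ha Hx Hz).
Qed.

Lemma large_canf_limit x : x ∈ kp -> limit x -> large (fun a => limit (canf b k x a)).
Proof.
intros Hx Lx.
assert (H : large (fun a => forall z, z ∈ canF b k x a -> succ z ∈ canF b k x a)).
{ apply large_canF_diag; auto; intros z Hz; apply large_canF_mem; auto.
  now apply Lx. }
refine (large_mono _ (large_and H (large_canF_mem Hx (limit_empty Lx)))).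
intros a Ha Ra [H1 H2]; split; [|split].
- apply (ordinal_ot (proj1 Lx)); intros z Hz; exact (mem_canF Ha Hx Hz).
- intro E; assert (H3 : collapse (canF b k x a) empty ∈ canf b k x a).
  { apply mem_ot; eauto. }
  rewrite E in H3; now apply mem_empty in H3.
- intros y Hy; apply mem_ot in Hy; destruct Hy as [z [Hz ->]].
  rewrite <- collapse_succ by auto; apply mem_ot; eauto.
Qed.

Lemma mem_canf x a z : upto a -> x ∈ kp -> z ∈ canf b k x a ->
  canpi_inv b k x a z ∈ canF b k x a /\
  collapse (canF b k x a) (canpi_inv b k x a z) = z.
Proof.
intros Ha Hx Hz; refine (collapse_invP (ordinal_below Hx) _ Hz).
intros w Hw; exact (mem_canF Ha Hx Hw).
Qed.

Lemma canpi_invK x a z : upto a -> x ∈ kp -> z ∈ canF b k x a ->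
  canpi_inv b k x a (collapse (canF b k x a) z) = z.
Proof.
intros Ha Hx Hz; refine (collapse_invK (ordinal_below Hx) _ Hz).
intros w Hw; exact (mem_canF Ha Hx Hw).
Qed.

(** Truth does not see the reindexing by the collapse, so with index set [canF b k x a] the levels
    below [k] and from [k] on look alike. *)
Lemma sat_restr_Conj a s1 s2 x f : upto a -> x ∈ kp ->
  sat a s1 s2 (restr b k a (Conj x f)) <->
  forall z, z ∈ canF b k x a -> sat a s1 s2 (restr b k a (f z)).
Proof.
intros Ha Hx; change (Conj x f) with (junct true x f).
destruct (classic (x ∈ k)) as [Hk|Hk].
- rewrite (restr_junct_small b a true f Hk), canF_small by auto; reflexivity.
- rewrite (restr_junct_large b a true f Hk); simpl; split; intros H z Hz.
  + rewrite <- (canpi_invK Ha Hx Hz); apply H, mem_ot; eauto.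
  + apply H; exact (proj1 (mem_canf Ha Hx Hz)).
Qed.

Lemma sat_restr_Disj a s1 s2 x f : upto a -> x ∈ kp ->
  sat a s1 s2 (restr b k a (Disj x f)) <->
  exists z, z ∈ canF b k x a /\ sat a s1 s2 (restr b k a (f z)).
Proof.
intros Ha Hx; change (Disj x f) with (junct false x f).
destruct (classic (x ∈ k)) as [Hk|Hk].
- rewrite (restr_junct_small b a false f Hk), canF_small by auto; reflexivity.
- rewrite (restr_junct_large b a false f Hk); simpl; split; intros [z [Hz H]].
  + exists (canpi_inv b k x a z); split; auto; exact (proj1 (mem_canf Ha Hx Hz)).
  + exists (collapse (canF b k x a) z); rewrite (canpi_invK Ha Hx Hz).
    split; auto; apply mem_ot; eauto.
Qed.

Lemma canF_k x : x ∈ kp -> canF b k x k = x.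
Proof.
intro Hx; destruct (classic (x ∈ k)) as [Hk|Hk]; [now apply canF_small|].
rewrite canF_large by auto; destruct (canonical_bijection Hx Hk) as [H1 [_ H2]].
apply mem_ext; intro z; rewrite mem_image; split.
- intros [i [Hi ->]]; auto.
- intro Hz; destruct (H2 z Hz) as [i [Hi E]]; eauto.
Qed.

(** At [k] the index set [canF b k x k] is all of [x] and the parameters are unchanged, so junctions
    are at most reindexed. Through this, facts that hold for large [a] give truth in [V k]. *)
Lemma sat_restr_k s1 s2 s x p : x ∈ kp -> lev k s x p ->
  sat k s1 s2 (restr b k k p) <-> sat k s1 s2 p.
Proof.
intros Hx Hp; revert s2; revert s x p Hp Hx; refine (lev_ind _ _ _).
- intros s p Hp _ s2; simpl; now rewrite fo_restr_self.
- intros s x ns p _ IH Hx s2; specialize (IH (below_trans Hx (mem_succ_self x))).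
  rewrite restr_fold; revert s2; induction ns as [|n ns IHn]; intro s2; simpl; auto.
  destruct s; simpl.
  + split; intros H X HX; apply IHn; auto.
  + split; intros [X [HX H]]; exists X; split; auto; now apply IHn.
- intros s x p Lx _ IH _ _ Hx s2.
  assert (E : forall z, z ∈ x ->
    (sat k s1 s2 (restr b k k (p z)) <-> sat k s1 s2 (p z))).
  { intros z Hz; apply IH; auto; exact (below_trans Hx Hz). }
  destruct s; cbn [junct];
    rewrite ?sat_restr_Conj, ?sat_restr_Disj, canF_k; try (now right); auto; simpl.
  + split; intros H z Hz; apply E; auto.
  + split; intros [z [Hz H]]; exists z; split; auto; now apply E.
Qed.

Lemma large_fo_par1 (q : fo U) : (forall c, fo_par1 q c -> c ∈ V k) ->
  large (fun a => forall c, fo_par1 q c -> c ∈ V a).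
Proof.
assert (T : forall t : term1 U, (forall c, term1_par t c -> c ∈ V k) ->
  large (fun a => forall c, term1_par t c -> c ∈ V a)).
{ intros [n|d] H.
  - apply large_intro; intros a _ _ c [].
  - refine (large_mono _ (large_mem (H d eq_refl))); intros a _ _ H' c ->; auto. }
assert (D : forall A B : U -> Prop,
  large (fun a => forall c, A c -> c ∈ V a) ->
  large (fun a => forall c, B c -> c ∈ V a) ->
  large (fun a => forall c, A c \/ B c -> c ∈ V a)).
{ intros A B HA HB; refine (large_mono _ (large_and HA HB)).
  intros a _ _ [H1 H2] c [Hc|Hc]; auto. }
induction q as [t u|t u|t u| |p IHp q IHq|n p IHp]; simpl; intro H; auto.
apply large_intro; intros a _ _ c [].
Qed.

(** The clauses on variables and parameters belong to the induction because a restricted junction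
    must again have finitely many of both. The levels match by [large_canf_succ], [large_canf_limit]
    and [large_canf_collapse]. *)
Lemma large_restr s x p : x ∈ kp -> lev k s x p -> large (fun a =>
  restr_defined b k a p /\ lev a s (canf b k x a) (restr b k a p) /\
  (forall n, fv2 (restr b k a p) n -> fv2 p n) /\
  (forall A, par2 (restr b k a p) A -> exists C, par2 p C /\ A = inter C (V a))).
Proof.
intros Hx Hp; revert s x p Hp Hx; refine (lev_ind _ _ _).
- intros s p Hp _; refine (large_mono _ (large_fo_par1 (proj1 Hp))).
  intros a Ha Ra H; rewrite canf_empty; split; [now simpl|split; [|split]].
  + apply lev_zero; exact (fo_over_restr Hp H).
  + intro n; apply fo_restr_fv2.
  + intro A; apply fo_restr_par2.
- intros s x ns p _ IH Hx; specialize (IH (below_trans Hx (mem_succ_self x))).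
  refine (large_mono _ (large_and IH (large_canf_succ Hx))).
  intros a Ha Ra [[H1 [H2 [H3 H4]]] E]; rewrite E, restr_fold, restr_defined_fold.
  split; [|split; [|split]]; auto.
  + now apply lev_succ.
  + intro n; rewrite !fv2_fold; intuition.
  + intro A; rewrite par2_fold; intro H; destruct (H4 A H) as [C [HC ->]].
    exists C; now rewrite par2_fold.
- intros s x p Lx _ IH F1 F2 Hx.
  assert (IH' : large (fun a => forall z, z ∈ canF b k x a ->
    (restr_defined b k a (p z) /\ lev a s (canf b k z a) (restr b k a (p z)) /\
     (forall n, fv2 (restr b k a (p z)) n -> fv2 (p z) n) /\
     (forall A, par2 (restr b k a (p z)) A ->
        exists C, par2 (p z) C /\ A = inter C (V a))) /\
    canf b k z a = collapse (canF b k x a) z)).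
  { apply large_canF_diag; auto; intros z Hz; apply large_and.
    - apply IH; auto; exact (below_trans Hx Hz).
    - now apply large_canf_collapse. }
  refine (large_mono _ (large_and IH' (large_canf_limit Hx Lx))).
  clear IH IH'; intros a Ha Ra [IH Lf].
  assert (IH2 : forall z, z ∈ canf b k x a ->
    (canpi_inv b k x a z ∈ x /\ restr_defined b k a (p (canpi_inv b k x a z))) /\
    lev a s z (restr b k a (p (canpi_inv b k x a z))) /\
     (forall n, fv2 (restr b k a (p (canpi_inv b k x a z))) n ->
        fv2 (p (canpi_inv b k x a z)) n) /\
     (forall A, par2 (restr b k a (p (canpi_inv b k x a z))) A ->
        exists C, par2 (p (canpi_inv b k x a z)) C /\ A = inter C (V a))).
  { intros z Hz; destruct (mem_canf Ha Hx Hz) as [H1 H2].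
    destruct (IH _ H1) as [[H3 [H4 H5]] H6]; rewrite H6, H2 in H4.
    split; [split|split]; auto; exact (mem_canF Ha Hx H1). }
  assert (R : exists f, restr b k a (junct s x p) = junct s (canf b k x a) f /\
    forall z, z ∈ canf b k x a -> exists y, y ∈ x /\ lev a s z (f z) /\
      (forall n, fv2 (f z) n -> fv2 (p y) n) /\
      (forall A, par2 (f z) A -> exists C, par2 (p y) C /\ A = inter C (V a))).
  { destruct (classic (x ∈ k)) as [Hk|Hk].
    - exists (fun z => restr b k a (p z)); rewrite restr_junct_small by auto.
      assert (E : canf b k x a = x).
      { unfold canf; rewrite canF_small by auto; apply ot_ordinal, Lx. }
      rewrite E; split; auto; intros z Hz.
      rewrite canF_small in IH by auto; destruct (IH z Hz) as [[_ [H1 H2]] H3].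
      exists z; rewrite H3, (collapse_ordinal (proj1 Lx)) in H1; auto; now intro.
    - exists (fun z => restr b k a (p (canpi_inv b k x a z))).
      rewrite restr_junct_large by auto; split; auto; intros z Hz.
      exists (canpi_inv b k x a z); destruct (IH2 z Hz) as [[H1 _] H2]; auto. }
  destruct R as [f [-> Hf]].
  assert (G1 : forall n, fv2 (junct s (canf b k x a) f) n -> fv2 (junct s x p) n).
  { intro n; rewrite !fv2_junct; intros [z [Hz H]].
    destruct (Hf z Hz) as [y [Hy [_ [H' _]]]]; eauto. }
  assert (G2 : forall A, par2 (junct s (canf b k x a) f) A ->
    exists C, par2 (junct s x p) C /\ A = inter C (V a)).
  { intro A; rewrite par2_junct; intros [z [Hz H]].
    destruct (Hf z Hz) as [y [Hy [_ [_ H']]]]; destruct (H' A H) as [C [HC ->]].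
    exists C; rewrite par2_junct; eauto. }
  split; [|split; [|split]]; auto.
  + rewrite restr_defined_junct; destruct (classic (x ∈ k)); [now left|right].
    split; auto; intros z Hz; destruct (IH2 z Hz) as [[_ H1] [H2 _]]; auto.
  + apply lev_limit; auto.
    * intros z Hz; destruct (Hf z Hz) as [y [_ [H _]]]; auto.
    * exact (finitely_many_sub G1 F1).
    * destruct F2 as [l Hl]; exists (map (fun C => inter C (V a)) l).
      intros A HA; destruct (G2 A HA) as [C [HC ->]].
      apply (in_map (fun C => inter C (V a))); auto.
Qed.

End Large.

(** * Coding parameters *)

Section Merge.
Context {U : zfc} (b : U -> U -> U -> U) (k kp : U)
  (Hb : canonical_bijections b) (Hkp : card_succ k kp) (Rk : regular k).
Implicit Types (x y z w a c : U).

(** The first-order leaves that survive the restriction to [a]. Discarded leaves may have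
    first-order parameters outside [V a], so equivalences are asked only of the surviving ones. *)
Fixpoint visited a (p : formula U) (q : fo U) : Prop :=
  match p with
  | FO r => q = r
  | All2 _ p | Ex2 _ p => visited a p q
  | Conj x f | Disj x f =>
      x ∈ k /\ (exists z, z ∈ x /\ visited a (f z) q) \/
      x ∉ k /\ (exists z, z ∈ canf b k x a /\ visited a (f (canpi_inv b k x a z)) q)
  end.

Lemma visited_fold a s p ns q :
  visited a (fold_right (quant s) p ns) q <-> visited a p q.
Proof. destruct s; induction ns; simpl in *; tauto. Qed.

Lemma visited_junct a s x f q : upto k a -> x ∈ kp ->
  visited a (junct s x f) q -> exists z, z ∈ canF b k x a /\ visited a (f z) q.
Proof.
intros Ha Hx H; assert (H' : x ∈ k /\ (exists z, z ∈ x /\ visited a (f z) q) \/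
  x ∉ k /\ (exists z, z ∈ canf b k x a /\ visited a (f (canpi_inv b k x a z)) q))
  by now destruct s.
destruct H' as [[Hk [z [Hz H']]]|[Hk [z [Hz H']]]].
- exists z; now rewrite canF_small.
- exists (canpi_inv b k x a z); split; auto.
  exact (proj1 (mem_canf Hb Hkp Rk Ha Hx Hz)).
Qed.

Lemma sat_restr_map_fo_iff a s1 g p :
  (forall q, visited a p q -> forall s2,
     fo_sat a s1 s2 (fo_restr a (g q)) <-> fo_sat a s1 s2 (fo_restr a q)) ->
  forall s2, sat a s1 s2 (restr b k a (map_fo g p)) <-> sat a s1 s2 (restr b k a p).
Proof.
induction p as [p|n p IH|n p IH|x p IH|x p IH]; simpl; intros H s2.
- now apply H.
- split; intros H' X HX; apply IH; auto.
- split; intros [X [HX H']]; exists X; split; auto; apply IH; auto.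
- match goal with |- context [excluded_middle_informative ?P] =>
    destruct (excluded_middle_informative P) end; simpl;
    split; intros H' z Hz; apply IH; eauto 8.
- match goal with |- context [excluded_middle_informative ?P] =>
    destruct (excluded_middle_informative P) end; simpl;
    split; intros [z [Hz H']]; exists z; split; auto; apply IH in H'; eauto 8;
    apply IH; eauto 8.
Qed.

Lemma large_visited s x p : x ∈ kp -> lev k s x p -> large k (fun a =>
  forall q, visited a p q ->
    (forall c, fo_par1 q c -> c ∈ V a) /\ (forall A, fo_par2 q A -> par2 p A)).
Proof.
intros Hx Hp; revert s x p Hp Hx; refine (lev_ind _ _ _).
- intros s p Hp _; refine (large_mono _ (large_fo_par1 Rk (proj1 Hp))).
  intros a Ha Ra H q; simpl; intros ->; auto.
- intros s x ns p _ IH Hx.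
  specialize (IH (below_trans Hkp Hx (mem_succ_self x))).
  refine (large_mono _ IH); intros a Ha Ra H q; rewrite visited_fold; intro Hq.
  destruct (H q Hq) as [H1 H2]; split; auto; intros A HA; apply par2_fold; auto.
- intros s x p Lx _ IH _ _ Hx.
  refine (large_mono _ (large_canF_diag Hb Hkp Rk (x := x) (P := fun z a =>
    forall q, visited a (p z) q ->
    (forall c, fo_par1 q c -> c ∈ V a) /\
    (forall A, fo_par2 q A -> par2 (p z) A)) _ _)).
  + intros a Ha Ra H q Hq; destruct (visited_junct Ha Hx Hq) as [z [Hz H']].
    destruct (H z Hz q H') as [H1 H2]; split; auto; intros A HA.
    apply par2_junct; exists z; split; auto.
    exact (mem_canF Hb Hkp Rk Ha Hx Hz).
  + auto.
  + intros z Hz; apply IH; auto; exact (below_trans Hkp Hx Hz).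
Qed.

Fixpoint encode (cd : U -> U) (K : U) (p : fo U) : fo U :=
  match p with
  | In2 t (Par2 A) => rel (Par1 (cd A)) t (Par2 K)
  | Eq _ _ | Mem _ _ | In2 _ (Var2 _) | Bot _ => p
  | Imp p q => Imp (encode cd K p) (encode cd K q)
  | All1 n p => All1 n (encode cd K p)
  end.

Lemma encode_fv1 cd K p i : fo_fv1 (encode cd K p) i -> fo_fv1 p i.
Proof.
induction p as [t u|t u|t [n|A]| |p IHp q IHq|n p IHp]; auto.
- intro H; apply fv1_rel in H; simpl in *; tauto.
- simpl; tauto.
- simpl; tauto.
Qed.

Lemma encode_fv2 cd K p i : fo_fv2 (encode cd K p) i -> fo_fv2 p i.
Proof.
induction p as [t u|t u|t [n|A]| |p IHp q IHq|n p IHp]; auto.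
- intro H; apply fv2_rel in H; simpl in *; tauto.
- simpl; tauto.
Qed.

Lemma encode_par2 cd K p A : fo_par2 (encode cd K p) A -> A = K.
Proof.
induction p as [t u|t u|t [n|C]| |p IHp q IHq|n p IHp]; simpl; intuition.
Qed.

Lemma encode_par1 cd K p c :
  fo_par1 (encode cd K p) c -> fo_par1 p c \/ exists A, c = cd A.
Proof.
induction p as [t u|t u|t [n|C]| |p IHp q IHq|n p IHp]; auto.
- intro H; apply par1_rel in H; simpl in *; destruct H as [->|H]; eauto.
- simpl; tauto.
Qed.

(** Restriction cuts [K] and [A] down to [V a] alike, and [V a] is closed under pairing, so coding
    commutes with restriction. *)
Lemma sat_encode a s1 s2 cd K p : limit a ->
  (forall n, s1 n ∈ V a) -> (forall c, fo_par1 p c -> c ∈ V a) ->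
  (forall A, fo_par2 p A -> cd A ∈ V a /\
     forall v, v ∈ V a -> (op (cd A) v ∈ K <-> v ∈ A)) ->
  fo_sat a s1 s2 (fo_restr a (encode cd K p)) <-> fo_sat a s1 s2 (fo_restr a p).
Proof.
intros La; revert s1; induction p as [t u|t u|t [n|A]| |p IHp q IHq|n p IHp];
  intros s1 Hs Hc HA; try reflexivity.
- destruct (HA A eq_refl) as [H1 H2].
  assert (Ht : eval1 s1 t ∈ V a).
  { destruct t as [n|c]; simpl; [auto|apply Hc; reflexivity]. }
  change (fo_restr a (encode cd K (In2 t (Par2 A)))) with
    (rel (Par1 (cd A)) t (Par2 (inter K (V a)))).
  rewrite sat_rel by auto; simpl; rewrite !mem_inter, <- (H2 _ Ht).
  pose proof (V_op La H1 Ht); tauto.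
- simpl in *; rewrite IHp, IHq; [reflexivity| | | | | |]; auto.
- simpl in *; split; intros H v Hv; apply IHp; auto; intro m; unfold upd;
    destruct (Nat.eqb m n); auto.
Qed.

Lemma small_index x : x ∈ kp -> exists j : U -> U,
  (forall z, z ∈ x -> j z ∈ V k) /\
  forall y z, y ∈ x -> z ∈ x -> j y = j z -> y = z.
Proof.
intro Hx; destruct (classic (x ∈ k)) as [Hk|Hk].
- exists (fun z => z); split; auto; intros z Hz; apply subset_V.
  exact (ordinal_trans (ordinal_card Hkp) Hz Hk).
- destruct (canonical_bijection Hb Hkp Rk Hx Hk) as [_ [_ H]].
  apply mem_choice in H; [|exact (inhabits empty)]; destruct H as [j Hj].
  exists j; split.
  + intros z Hz; apply subset_V; now apply Hj.
  + intros y z Hy Hz E; destruct (Hj y Hy) as [_ <-], (Hj z Hz) as [_ <-].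
    now rewrite E.
Qed.

(* The conjuncts of a formula of limit level share finitely many second-order
   parameters; [k] many parameters are coded in the single parameter [K] by
   means of first-order parameters, of which there may be infinitely many. *)
Lemma merge_parameters x s (f : U -> formula U) : x ∈ kp ->
  (forall z, z ∈ x -> lev k s z (f z)) ->
  exists (K : U) (g : U -> formula U), forall (z : U) (Hz : z ∈ x),
    lev k s z (g z) /\ (forall n, fv1 (g z) n -> fv1 (f z) n) /\
    (forall n, fv2 (g z) n -> fv2 (f z) n) /\ (forall A, par2 (g z) A -> A = K) /\
    large k (fun a => forall s2,
      sat a noval s2 (restr b k a (g z)) <-> sat a noval s2 (restr b k a (f z))).
Proof.
intros Hx Hf; assert (Lk := regular_limit Rk).
destruct (small_index Hx) as [j [Hj Ij]].
assert (F : forall z, z ∈ x -> finitely_many (par2 (f z))).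
{ intros z Hz; exact (lev_finite_par2 (Hf z Hz)). }
apply mem_choice in F; [|exact (inhabits nil)]; destruct F as [l Hl].
set (K := sep (V k) (fun w => exists z n A v, z ∈ x /\
  nth_error (l z) n = Some A /\ v ∈ A /\ w = op (op (j z) (num n)) v)).
(* [epsilon] picks a position of [A] in the list [l z]; if [A] is repeated, any position will do. *)
set (cd := fun z A => op (j z) (num (epsilon (inhabits 0)
  (fun n => nth_error (l z) n = Some A)))).
exists K, (fun z => map_fo (encode (cd z) K) (f z)).
assert (HK : K ⊆ V k) by (intros w Hw; apply mem_sep in Hw; tauto).
assert (Hcd : forall z A a, limit a -> j z ∈ V a -> cd z A ∈ V a).
{ intros z A a La H; apply V_op; auto; now apply V_num. }
intros z Hz; split; [|split; [|split; [|split]]].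
- apply lev_map_fo; auto.
  + intros q [H1 H2]; split.
    * intros c Hc; apply encode_par1 in Hc; destruct Hc as [Hc|[A ->]]; auto.
    * intros A HA; now apply encode_par2 in HA as ->.
  + intros q i; apply encode_fv2.
  + exists (K :: nil); intros A [q [H _]]; left; symmetry; exact (encode_par2 H).
- intro n; apply map_fo_fv1; intro q; apply encode_fv1.
- intro n; apply map_fo_fv2; intro q; apply encode_fv2.
- intros A; clear; induction (f z) as [p|n p IH|n p IH|y p IH|y p IH]; simpl; auto.
  + apply encode_par2.
  + intros [w [_ H]]; eauto.
  + intros [w [_ H]]; eauto.
- assert (Hzk := below_trans Hkp Hx Hz).
  refine (large_mono _ (large_and Rk (large_visited Hzk (Hf z Hz))
    (large_mem (Hj z Hz)))).
  intros a Ha Ra [H Hja]; assert (La := regular_limit Ra).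
  apply sat_restr_map_fo_iff; intros q Hq s2; destruct (H q Hq) as [H1 H2].
  apply sat_encode; auto.
  + intro n; now apply V_empty.
  + intros A HA; split; auto; intros v Hv.
    assert (E : nth_error (l z) (epsilon (inhabits 0)
      (fun n => nth_error (l z) n = Some A)) = Some A).
    { apply epsilon_spec with (P := fun n => nth_error (l z) n = Some A).
      apply In_nth_error; auto. }
    unfold K; rewrite mem_sep; split.
    * intros [_ [y [n [C [u [Hy [HC [Hu E']]]]]]]].
      apply op_inj in E'; destruct E' as [E' <-]; apply op_inj in E'.
      destruct E' as [E1 E2]; apply num_inj in E2; apply Ij in E1; auto; subst.
      rewrite E in HC; now injection HC as ->.
    * intro HvA; split; [|eauto 9].
      apply V_op; auto; apply upto_V with (a := a) (1 := Hkp); auto.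
Qed.

End Merge.

(** * First-order truth *)

Section TruthFormula.
Context {U : zfc}.
Implicit Types (x y z w a c d : U).

(** A subset of [V a] codes a sequence of subsets by its sections, so one set variable can stand for
    a whole block of them. *)
Definition slice a (n : nat) (X : U) : U :=
  sep (V a) (fun v => op (num n) v ∈ X).

(* Total on subsets of [V a], so that no restriction to codes is needed when
   the index is quantified away. *)
Definition decode a (X : U) : U :=
  if excluded_middle_informative (X ∈ V a) then X else empty.

Fixpoint big_or (F : nat -> fo U) (n : nat) : fo U :=
  match n with 0 => Bot U | S n => fo_or (F n) (big_or F n) end.

Definition v0 : term1 U := Var1 0.
Definition v1 : term1 U := Var1 1.

Definition edge_fo (T : term2 U) (Cn Cp : U) (G : nat -> U) (m : nat) : fo U :=
  fo_ex 1 (fo_or (fo_and (rel v0 v1 (Par2 Cn)) (fo_not (In2 v1 T)))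
          (fo_or (fo_and (rel v0 v1 (Par2 Cp)) (In2 v1 T))
                 (big_or (fun j => fo_and (rel v0 v1 (Par2 (G j)))
                                          (In2 v1 (Var2 j))) (S m)))).

(* [T] contains the node [d] if and only if some edge leads from [d] to a node
   outside [T] (edges in [Cn]), to a node in [T] (in [Cp]) or to an element of
   the set variable [j] (in [G j]); for [d] in [Q] this condition is negated. *)
Definition tarski_fo (T : term2 U) (Cn Cp Q : U) (G : nat -> U) (m : nat) : fo U :=
  All1 0 (fo_iff (In2 v0 T)
                 (fo_iff (edge_fo T Cn Cp G m) (fo_not (In2 v0 (Par2 Q))))).

Definition code_fo (n : nat) : fo U :=
  All1 2 (fo_iff (Mem (Var1 2) (Var1 n)) (In2 (Var1 2) (Var2 0))).

(** The second disjunct mirrors the default in [decode]: a set that is no element of [V a] is read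
    as the index [empty]. *)
Definition root_fo (T : term2 U) (R : U) : fo U :=
  fo_ex 0 (fo_and (fo_or (code_fo 0) (fo_and (Eq v0 (Par1 empty))
                                             (fo_not (fo_ex 1 (code_fo 1)))))
                  (fo_ex 1 (fo_and (rel v0 v1 (Par2 R)) (In2 v1 T)))).

(** The variable [S m] is to be quantified universally. Truth predicates exist and agree on nodes,
    so membership of the root in all of them is truth, expressed by a Pi formula of level one. *)
Definition truth_fo (Cn Cp Q R : U) (G : nat -> U) (m : nat) : fo U :=
  Imp (tarski_fo (Var2 (S m)) Cn Cp Q G m) (root_fo (Var2 (S m)) R).

Lemma restr_big_or a F n :
  fo_restr a (big_or F n) = big_or (fun j => fo_restr a (F j)) n.
Proof.
induction n as [|n IH]; auto; cbn [big_or]; unfold fo_or, fo_not.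
cbn [fo_restr]; now rewrite IH.
Qed.

Lemma restr_truth_fo a Cn Cp Q R G m : fo_restr a (truth_fo Cn Cp Q R G m) =
  truth_fo (inter Cn (V a)) (inter Cp (V a)) (inter Q (V a)) (inter R (V a))
    (fun j => inter (G j) (V a)) m.
Proof.
unfold truth_fo, tarski_fo, edge_fo, fo_ex, fo_or, fo_and, fo_iff, fo_and, fo_not.
cbn [fo_restr]; now rewrite restr_big_or.
Qed.

Lemma sat_big_or a s1 s2 F n : fo_sat a s1 s2 (big_or F n) <->
  exists j, j < n /\ fo_sat a s1 s2 (F j).
Proof.
induction n as [|n IH].
- simpl; split; [tauto|intros [j [H _]]; lia].
- cbn [big_or]; rewrite sat_or, IH; split.
  + intros [H|[j [H1 H2]]]; eauto.
  + intros [j [H1 H2]]; destruct (Nat.eq_dec j n) as [->|E]; auto.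
    right; exists j; split; auto; lia.
Qed.

Definition edge a (s2 : nat -> U) (T Cn Cp : U) (G : nat -> U) m d : Prop :=
  exists e, e ∈ V a /\ (op d e ∈ Cn /\ e ∉ T \/ op d e ∈ Cp /\ e ∈ T \/
    exists j, j < S m /\ op d e ∈ G j /\ e ∈ s2 j).

Lemma sat_edge_fo a s1 s2 T Cn Cp G m : limit a -> s1 0 ∈ V a ->
  fo_sat a s1 s2 (edge_fo T Cn Cp G m) <->
  edge a s2 (eval2 s2 T) Cn Cp G m (s1 0).
Proof.
intros La Hs; unfold edge_fo, edge; rewrite sat_ex.
split; intros [e [He H]]; exists e; split; auto; revert H;
  rewrite sat_or, sat_or, !sat_and, sat_not, sat_big_or, !sat_rel;
  auto; cbn [fo_sat eval1 eval2 v0 v1 upd Nat.eqb]; intros [H|[H|[j [Hj H]]]]; auto;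
  right; right; exists j; split; auto;
  revert H; rewrite sat_and, sat_rel; auto.
Qed.

Lemma sat_tarski_fo a s1 s2 T Cn Cp Q G m : limit a ->
  fo_sat a s1 s2 (tarski_fo T Cn Cp Q G m) <->
  forall d, d ∈ V a ->
    (d ∈ eval2 s2 T <-> (edge a s2 (eval2 s2 T) Cn Cp G m d <-> d ∉ Q)).
Proof.
intro La; unfold tarski_fo; cbn [fo_sat].
split; intros H d Hd; specialize (H d Hd); revert H;
  rewrite !sat_iff, sat_not, sat_edge_fo; auto.
Qed.

Lemma sat_code_fo a s1 s2 n : ordinal a -> n <> 2 -> s1 n ∈ V a -> s2 0 ⊆ V a ->
  fo_sat a s1 s2 (code_fo n) <-> s1 n = s2 0.
Proof.
intros Oa Hn H1 H2; unfold code_fo; cbn [fo_sat].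
assert (E : (forall c, c ∈ V a -> (c ∈ s1 n <-> c ∈ s2 0)) <->
  forall c, c ∈ V a -> fo_sat a (upd s1 2 c) s2
    (fo_iff (Mem (Var1 2) (Var1 n)) (In2 (Var1 2) (Var2 0)))).
{ split; intros H c Hc; specialize (H c Hc); revert H; rewrite sat_iff;
    cbn [fo_sat eval1 eval2]; now rewrite upd_same, upd_other. }
rewrite <- E; split; [|intros -> c _; reflexivity].
intro H; apply mem_ext; intro c; split; intro Hc; apply H; auto.
exact (V_trans Oa Hc H1).
Qed.

Lemma sat_root_fo a s1 s2 T R : limit a -> s2 0 ⊆ V a ->
  fo_sat a s1 s2 (root_fo T R) <->
  exists e, e ∈ V a /\ op (decode a (s2 0)) e ∈ R /\ e ∈ eval2 s2 T.
Proof.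
intros La H0; assert (Oa := proj1 La); unfold root_fo; rewrite sat_ex.
assert (D : forall i, i ∈ V a -> (fo_sat a (upd s1 0 i) s2
  (fo_or (code_fo 0) (fo_and (Eq v0 (Par1 empty)) (fo_not (fo_ex 1 (code_fo 1)))))
  <-> i = decode a (s2 0))).
{ intros i Hi; rewrite sat_or, sat_and, sat_not, sat_ex, sat_code_fo; auto.
  cbn [fo_sat eval1 v0]; rewrite upd_same.
  assert (E : (exists c, c ∈ V a /\ fo_sat a (upd (upd s1 0 i) 1 c) s2 (code_fo 1))
    <-> s2 0 ∈ V a).
  { split.
    - intros [c [Hc H]]; rewrite sat_code_fo, upd_same in H; auto; now subst.
    - intro H; exists (s2 0); split; auto; rewrite sat_code_fo, upd_same; auto. }
  rewrite E; unfold decode.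
  destruct (excluded_middle_informative (s2 0 ∈ V a)) as [H|H]; [tauto|].
  split; [|tauto]; intros [->|H']; tauto. }
assert (X : forall i, i ∈ V a -> (fo_sat a (upd s1 0 i) s2
    (fo_ex 1 (fo_and (rel v0 v1 (Par2 R)) (In2 v1 T))) <->
    exists e, e ∈ V a /\ op i e ∈ R /\ e ∈ eval2 s2 T)).
{ intros i Hi; rewrite sat_ex; split; intros [e [He H]]; exists e; split; auto;
    revert H; rewrite sat_and, sat_rel; auto. }
assert (Hd : decode a (s2 0) ∈ V a).
{ unfold decode; destruct (excluded_middle_informative (s2 0 ∈ V a)); auto.
  now apply V_empty. }
split.
- intros [i [Hi H]]; rewrite sat_and, D, X in H; auto; now destruct H as [-> H].
- intro H; exists (decode a (s2 0)); split; auto; rewrite sat_and, D, X; auto.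
Qed.

Lemma big_or_fv1 F n i : fo_fv1 (big_or F n) i -> exists j, fo_fv1 (F j) i.
Proof. induction n; simpl; [tauto|]; intros [[H|[]]|H]; eauto. Qed.

Lemma big_or_fv2 F n i :
  fo_fv2 (big_or F n) i -> exists j, j < n /\ fo_fv2 (F j) i.
Proof.
induction n; simpl; [tauto|]; intros [[H|[]]|H]; eauto.
destruct (IHn H) as [j [H1 H2]]; eauto.
Qed.

Lemma big_or_par1 F n c : fo_par1 (big_or F n) c -> exists j, fo_par1 (F j) c.
Proof. induction n; simpl; [tauto|]; intros [[H|[]]|H]; eauto. Qed.

Lemma big_or_par2 F n A : fo_par2 (big_or F n) A -> exists j, fo_par2 (F j) A.
Proof. induction n; simpl; [tauto|]; intros [[H|[]]|H]; eauto. Qed.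

Lemma truth_fo_fv1 Cn Cp Q R G m i : ~ fo_fv1 (truth_fo Cn Cp Q R G m) i.
Proof.
assert (B : forall n, fo_fv1 (big_or (fun j => fo_and (rel v0 v1 (Par2 (G j)))
  (In2 v1 (Var2 j))) n) i -> i = 0 \/ i = 1).
{ intros n H; apply big_or_fv1 in H; destruct H as [j H]; simpl in H.
  intuition. }
specialize (B (S m)); unfold truth_fo, tarski_fo, edge_fo.
remember (big_or _ _) as p; simpl; intuition.
Qed.

Lemma truth_fo_fv2 Cn Cp Q R G m n :
  fo_fv2 (truth_fo Cn Cp Q R G m) n -> n <= S m.
Proof.
assert (B : forall l, l <= S m -> fo_fv2 (big_or (fun j => fo_and (rel v0 v1 (Par2 (G j)))
  (In2 v1 (Var2 j))) l) n -> n <= S m).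
{ intros l Hl H; apply big_or_fv2 in H; destruct H as [j [Hj H]]; simpl in H.
  intuition lia. }
specialize (B (S m) (le_n _)); unfold truth_fo, tarski_fo, edge_fo.
remember (big_or _ _) as p; simpl; intuition lia.
Qed.

Lemma truth_fo_over k Cn Cp Q R G m : limit k ->
  Cn ⊆ V k -> Cp ⊆ V k -> Q ⊆ V k -> R ⊆ V k -> (forall j, G j ⊆ V k) ->
  fo_over k (truth_fo Cn Cp Q R G m).
Proof.
intros Lk H1 H2 H3 H4 H5; split.
- intros c.
  assert (B : forall n, ~ fo_par1 (big_or (fun j => fo_and (rel v0 v1 (Par2 (G j)))
    (In2 v1 (Var2 j))) n) c).
  { intros n H; apply big_or_par1 in H; destruct H as [j H]; simpl in H; tauto. }
  specialize (B (S m)); unfold truth_fo, tarski_fo, edge_fo.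
  remember (big_or _ _) as p; simpl.
  pose proof (V_empty Lk); intuition; now subst.
- intros A.
  assert (B : forall n, fo_par2 (big_or (fun j => fo_and (rel v0 v1 (Par2 (G j)))
    (In2 v1 (Var2 j))) n) A -> A ⊆ V k).
  { intros n H; apply big_or_par2 in H; destruct H as [j H]; simpl in H.
    assert (A = G j) as -> by tauto; auto. }
  specialize (B (S m)); unfold truth_fo, tarski_fo, edge_fo.
  remember (big_or _ _) as p; simpl.
  intuition; now subst.
Qed.

End TruthFormula.

(** * Evaluation trees and their truth predicates *)

Section Nodes.
Context {U : zfc} (p : U -> fo U) (r : U -> nat -> nat).
Implicit Types (x y z w a c d i : U) (l : list U).

(* A node of the evaluation tree of [p i] is reached from the root by a list of
   labels, the last one first: at an implication the label [empty] leads to the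
   premise and any other label to the conclusion; at a universal quantifier the
   label is the value of the variable. *)
Definition step (S : fo U * (nat -> U)) c : fo U * (nat -> U) :=
  match S with
  | (Imp q q', s) => if excluded_middle_informative (c = empty) then (q, s) else (q', s)
  | (All1 n q, s) => (q, upd s n c)
  | _ => S
  end.

Fixpoint state i l : fo U * (nat -> U) :=
  match l with nil => (p i, noval) | c :: l => step (state i l) c end.

Fixpoint encode_list l : U :=
  match l with nil => empty | c :: l => op c (encode_list l) end.

Definition node i l : U := op i (encode_list l).

Lemma encode_list_inj l l' : encode_list l = encode_list l' -> l = l'.
Proof.
revert l'; induction l as [|c l IH]; intros [|c' l'] H; simpl in H; auto.
- symmetry in H; now apply op_neq_empty in H.
- now apply op_neq_empty in H.
- apply op_inj in H; destruct H as [-> H]; f_equal; auto.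
Qed.

Lemma node_inj i l j l' : node i l = node j l' -> i = j /\ l = l'.
Proof.
intro H; apply op_inj in H; destruct H as [H1 H2]; split; auto.
now apply encode_list_inj.
Qed.

Definition labels a l : Prop := forall c, In c l -> c ∈ V a.

Lemma V_node a i l : limit a -> node i l ∈ V a <-> i ∈ V a /\ labels a l.
Proof.
intro La.
assert (H : encode_list l ∈ V a <-> labels a l).
{ induction l as [|c l IH]; simpl.
  - split; [intros _ c []|intros _; now apply V_empty].
  - split.
    + intro H; apply V_op_inv in H; [|apply La]; destruct H as [H1 H2].
      apply IH in H2; intros d [<-|Hd]; auto.
    + intro H; apply V_op; auto; [apply H; now left|].
      apply IH; intros d Hd; apply H; now right. }
rewrite <- H; split.
- intro H'; apply V_op_inv in H'; auto; apply La.
- intros [H1 H2]; now apply V_op.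
Qed.

Lemma labels_cons a c l : c ∈ V a -> labels a l -> labels a (c :: l).
Proof. intros Hc Hl d [<-|Hd]; auto. Qed.

Lemma state_val a i l n : limit a -> labels a l -> snd (state i l) n ∈ V a.
Proof.
intros La; revert n; induction l as [|c l IH]; intros n H; simpl.
- now apply V_empty.
- assert (IH' := fun n => IH n (fun d Hd => H d (or_intror Hd))).
  destruct (state i l) as [[t u|t u|t T| |q q'|m q] s]; simpl in *; auto.
  + destruct (excluded_middle_informative (c = empty)); simpl; auto.
  + unfold upd; destruct (Nat.eqb n m); auto; apply H; now left.
Qed.

Lemma state_par1 i l c : fo_par1 (fst (state i l)) c -> fo_par1 (p i) c.
Proof.
induction l as [|d l IH]; simpl; auto.
destruct (state i l) as [[t u|t u|t T| |q q'|m q] s]; simpl in *; auto.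
destruct (excluded_middle_informative (d = empty)); simpl; auto.
Qed.

Definition truth a (s2 : nat -> U) i l : Prop :=
  fo_sat a (snd (state i l)) (fun n => slice a n (s2 (r i n)))
    (fo_restr a (fst (state i l))).

(** These relations are fixed over [V k], and their traces on [V a] are the right ones for [V a]:
    one list of parameters expresses truth in all suitable [V a]. Negative edges lead from an
    implication to its premise and from a quantifier to its instances. *)
Definition Cneg k : U := sep (V k) (fun w => exists i l c,
  w = op (node i l) (node i (c :: l)) /\
  match fst (state i l) with
  | Imp _ _ => c = empty | All1 _ _ => True | _ => False
  end).

Definition Cpos k : U := sep (V k) (fun w => exists i l,
  w = op (node i l) (node i (num 1 :: l)) /\
  match fst (state i l) with Imp _ _ => True | _ => False end).

(** An atom about the set variable [n] with term value [v] is true when [op (num n) v] belongs to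
    the variable coding that sequence; the edge leads to this pair. *)
Definition Catom k (j : nat) : U := sep (V k) (fun w => exists i l n,
  w = op (node i l) (op (num n) (eval1 (snd (state i l))
    match fst (state i l) with In2 t _ => t | _ => Par1 empty end)) /\
  r i n = j /\ exists t, fst (state i l) = In2 t (Var2 n)).

(** At a quantifier, negating the edge condition turns the failure of some instance into the truth
    of all. An atom without set variable has no edges, so it is true exactly when listed here; truth
    over [V k] is the right test because its terms take values in [V a]. *)
Definition Cdual k : U := sep (V k) (fun w => exists i l,
  w = node i l /\
  match fst (state i l) with
  | All1 _ _ => True
  | Eq _ _ | Mem _ _ | In2 _ (Par2 _) =>
      fo_sat k (snd (state i l)) noval (fst (state i l))
  | _ => False
  end).

Definition Croot k : U := sep (V k) (fun w => exists i, w = op i (node i nil)).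

Definition tarski k a (s2 : nat -> U) (m : nat) T : Prop := forall d, d ∈ V a ->
  (d ∈ T <-> (edge a s2 T (inter (Cneg k) (V a)) (inter (Cpos k) (V a))
                (fun j => inter (Catom k j) (V a)) m d <->
              d ∉ inter (Cdual k) (V a))).

Context (k a : U) (s2 : nat -> U) (m : nat) (La : limit a) (Hka : V a ⊆ V k)
  (Hp : forall i, i ∈ V a -> forall c, fo_par1 (p i) c -> c ∈ V a)
  (Hr : forall i n, r i n <= m).

Lemma eval_state i l t : i ∈ V a -> labels a l ->
  (forall c, term1_par t c -> fo_par1 (fst (state i l)) c) ->
  eval1 (snd (state i l)) t ∈ V a.
Proof.
intros Hi Hl Ht; destruct t as [n|c]; simpl; [now apply state_val|].
apply (Hp Hi), (@state_par1 i l); apply Ht; reflexivity.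
Qed.

Lemma edge_node T i l : i ∈ V a -> labels a l ->
  edge a s2 T (inter (Cneg k) (V a)) (inter (Cpos k) (V a))
    (fun j => inter (Catom k j) (V a)) m (node i l) <->
  match fst (state i l) with
  | Imp _ _ => node i (empty :: l) ∉ T \/ node i (num 1 :: l) ∈ T
  | All1 _ _ => exists c, c ∈ V a /\ node i (c :: l) ∉ T
  | In2 t (Var2 n) => op (num n) (eval1 (snd (state i l)) t) ∈ s2 (r i n)
  | _ => False
  end.
Proof.
intros Hi Hl; assert (Hn : node i l ∈ V a) by (apply V_node; auto).
assert (Hc : forall c, c ∈ V a -> node i (c :: l) ∈ V a).
{ intros c Hc; apply V_node; auto using labels_cons. }
assert (I : forall A w, w ∈ V a -> w ∈ A -> w ∈ inter A (V a)).
{ intros A w H1 H2; apply mem_inter; auto. }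
pose proof (fun t => @eval_state i l t Hi Hl) as Ev.
unfold edge; split.
- intros [e [He [[H HT]|[[H HT]|[j [Hj [H HT]]]]]]];
    apply mem_inter in H; destruct H as [H _]; unfold Cneg, Cpos, Catom in H;
    rewrite mem_sep in H; destruct H as [_ H].
  + destruct H as [i' [l' [c [E H]]]]; apply op_inj in E; destruct E as [E ->].
    apply node_inj in E; destruct E as [<- <-].
    destruct (fst (state i l)) as [t u|t u|t T'| |q q'|n q]; try contradiction.
    * subst; auto.
    * apply V_node in He; auto; exists c; split; auto; apply He; now left.
  + destruct H as [i' [l' [E H]]]; apply op_inj in E; destruct E as [E ->].
    apply node_inj in E; destruct E as [<- <-].
    destruct (fst (state i l)) as [t u|t u|t T'| |q q'|n q]; try contradiction; auto.
  + destruct H as [i' [l' [n [E [H [t Ht]]]]]]; apply op_inj in E; destruct E as [E ->].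
    apply node_inj in E; destruct E as [<- <-]; rewrite Ht in *; now subst.
- remember (fst (state i l)) as Q eqn:EQ; symmetry in EQ.
  destruct Q as [t u|t u|t [n|A]| |q q'|n q]; try contradiction.
  + intro H; exists (op (num n) (eval1 (snd (state i l)) t)).
    assert (Ht : eval1 (snd (state i l)) t ∈ V a) by (apply Ev; simpl; auto).
    assert (Hop := V_op La (V_num n La) Ht).
    split; auto; right; right; exists (r i n); split; [specialize (Hr i n); lia|].
    split; auto; apply I; [now apply V_op|].
    unfold Catom; rewrite mem_sep; split; [now apply Hka, V_op|].
    exists i, l, n; rewrite EQ; eauto.
  + intros [H|H].
    * exists (node i (empty :: l)); pose proof (Hc _ (V_empty La)); split; auto.
      left; split; auto; apply I; [now apply V_op|].
      unfold Cneg; rewrite mem_sep; split; [now apply Hka, V_op|].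
      exists i, l, empty; now rewrite EQ.
    * exists (node i (num 1 :: l)); pose proof (Hc _ (V_num 1 La)); split; auto.
      right; left; split; auto; apply I; [now apply V_op|].
      unfold Cpos; rewrite mem_sep; split; [now apply Hka, V_op|].
      exists i, l; now rewrite EQ.
  + intros [c [Hc' H]]; exists (node i (c :: l)); pose proof (Hc _ Hc'); split; auto.
    left; split; auto; apply I; [now apply V_op|].
    unfold Cneg; rewrite mem_sep; split; [now apply Hka, V_op|].
    exists i, l, c; now rewrite EQ.
Qed.

Lemma dual_node i l : i ∈ V a -> labels a l ->
  node i l ∈ inter (Cdual k) (V a) <->
  match fst (state i l) with
  | All1 _ _ => True
  | Eq _ _ | Mem _ _ | In2 _ (Par2 _) => truth a s2 i l
  | _ => False
  end.
Proof.
intros Hi Hl; assert (Hn : node i l ∈ V a) by (apply V_node; auto).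
pose proof (fun t => @eval_state i l t Hi Hl) as Ev.
assert (E : node i l ∈ inter (Cdual k) (V a) <->
  match fst (state i l) with
  | All1 _ _ => True
  | Eq _ _ | Mem _ _ | In2 _ (Par2 _) =>
      fo_sat k (snd (state i l)) noval (fst (state i l))
  | _ => False
  end).
{ unfold Cdual; rewrite mem_inter, mem_sep; split.
  - intros [[_ [i' [l' [E H]]]] _]; apply node_inj in E; now destruct E as [<- <-].
  - intro H; split; auto; split; auto; exists i, l; auto. }
rewrite E; unfold truth.
destruct (fst (state i l)) as [t u|t u|t [n|A]| |q q'|n q]; simpl; try reflexivity.
rewrite mem_inter; pose proof (Ev t) as Ht; simpl in Ht; intuition.
Qed.

(** The uniform edge condition unfolds, at each kind of node, into the Tarski clause for its
    connective. *)
Lemma node_equation T i l : i ∈ V a -> labels a l ->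
  (edge a s2 T (inter (Cneg k) (V a)) (inter (Cpos k) (V a))
     (fun j => inter (Catom k j) (V a)) m (node i l) <->
   node i l ∉ inter (Cdual k) (V a)) <->
  match fst (state i l) with
  | Imp _ _ => node i (empty :: l) ∈ T -> node i (num 1 :: l) ∈ T
  | All1 _ _ => forall c, c ∈ V a -> node i (c :: l) ∈ T
  | _ => truth a s2 i l
  end.
Proof.
intros Hi Hl; rewrite (edge_node T Hi Hl), (dual_node Hi Hl).
pose proof (fun t => @eval_state i l t Hi Hl) as Ev; unfold truth.
destruct (fst (state i l)) as [t u|t u|t [n|A]| |q q'|n q]; simpl; try tauto.
- unfold slice; rewrite mem_sep; pose proof (Ev t) as Ht; simpl in Ht; intuition.
- split; [|intros H; split; [|tauto]].
  + intros H c Hc; apply NNPP; intro H'; apply H; eauto.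
  + intros [c [Hc H']]; destruct (H' (H c Hc)).
Qed.

Lemma truth_node i l : truth a s2 i l <->
  match fst (state i l) with
  | Imp _ _ => truth a s2 i (empty :: l) -> truth a s2 i (num 1 :: l)
  | All1 _ _ => forall c, c ∈ V a -> truth a s2 i (c :: l)
  | _ => truth a s2 i l
  end.
Proof.
unfold truth; simpl.
destruct (state i l) as [[t u|t u|t [n|A]| |q q'|n q] s]; simpl; try reflexivity.
destruct (excluded_middle_informative (empty = empty)) as [_|H]; [|now destruct H].
destruct (excluded_middle_informative (succ empty = empty)) as [H|_]; [|reflexivity].
now apply succ_neq_empty in H.
Qed.

(** Uniqueness of truth predicates on nodes, by induction on the formula at the node and not on its
    list of labels. *)
Lemma tarski_truth T i l : tarski k a s2 m T -> i ∈ V a -> labels a l ->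
  node i l ∈ T <-> truth a s2 i l.
Proof.
intros HT Hi Hl; remember (fst (state i l)) as q eqn:Eq.
revert l Hl Eq; induction q as [t u|t u|t [n|A]| |q IHq q' IHq'|n q IHq];
  intros l Hl Eq; rewrite (HT (node i l)) by (apply V_node; auto);
  rewrite (node_equation T Hi Hl), truth_node, <- Eq; try reflexivity.
- rewrite IHq, IHq'; try reflexivity; auto using labels_cons, V_empty, V_num.
  + simpl; destruct (state i l) as [S s]; simpl in *; subst; simpl.
    destruct (excluded_middle_informative (succ empty = empty)) as [H|_]; auto.
    now apply succ_neq_empty in H.
  + simpl; destruct (state i l) as [S s]; simpl in *; subst; simpl.
    destruct (excluded_middle_informative (empty = empty)) as [_|H]; auto.
    now destruct H.
- assert (E : forall c, c ∈ V a -> (node i (c :: l) ∈ T <-> truth a s2 i (c :: l))).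
  { intros c Hc; apply IHq; auto using labels_cons; simpl.
    destruct (state i l) as [S s]; simpl in *; now subst. }
  split; intros H c Hc; apply E; auto.
Qed.

Lemma tarski_exists : exists T, T ⊆ V a /\ tarski k a s2 m T.
Proof.
set (T := sep (V a) (fun d => exists i l, d = node i l /\ truth a s2 i l)).
assert (HT : forall i l, i ∈ V a -> labels a l -> (node i l ∈ T <-> truth a s2 i l)).
{ intros i l Hi Hl; unfold T; rewrite mem_sep; split.
  - intros [_ [i' [l' [E H]]]]; apply node_inj in E; now destruct E as [<- <-].
  - intro H; split; [apply V_node; auto|eauto]. }
exists T; split; [intros d Hd; now apply mem_sep in Hd|]; intros d Hd.
destruct (classic (exists i l, d = node i l)) as [[i [l ->]]|Nd].
- apply V_node in Hd; auto; destruct Hd as [Hi Hl].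
  rewrite (node_equation T Hi Hl), (HT i l Hi Hl), truth_node.
  destruct (fst (state i l)) as [t u|t u|t [n|A]| |q q'|n q]; try reflexivity.
  + rewrite !HT; auto using labels_cons, V_empty, V_num; reflexivity.
  + split; intros H c Hc; apply HT; auto using labels_cons.
(* Off the nodes there are no edges and no elements of [Cdual], so the equation demands [d ∉ T]. *)
- assert (H1 : d ∉ T).
  { intro H; apply mem_sep in H; destruct H as [_ [i [l [E _]]]]; eauto. }
  assert (H2 : d ∉ inter (Cdual k) (V a)).
  { intro H; apply mem_inter in H; destruct H as [H _]; unfold Cdual in H.
    rewrite mem_sep in H; destruct H as [_ [i [l [E _]]]]; eauto. }
  assert (H3 : ~ edge a s2 T (inter (Cneg k) (V a)) (inter (Cpos k) (V a))
     (fun j => inter (Catom k j) (V a)) m d); [|tauto].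
  intros [e [_ [[H _]|[[H _]|[j [_ [H _]]]]]]]; apply mem_inter in H;
    destruct H as [H _]; unfold Cneg, Cpos, Catom in H; rewrite mem_sep in H;
    destruct H as [_ H]; apply Nd.
  + destruct H as [i [l [c [E _]]]]; apply op_inj in E; destruct E; eauto.
  + destruct H as [i [l [E _]]]; apply op_inj in E; destruct E; eauto.
  + destruct H as [i [l [n [E _]]]]; apply op_inj in E; destruct E; eauto.
Qed.
End Nodes.

(** * Selecting among first-order formulas *)

Section Selection.
Context {U : zfc} (b : U -> U -> U -> U) (k kp : U)
  (Hb : canonical_bijections b) (Hkp : card_succ k kp) (Rk : regular k).
Implicit Types (x y z w a c i : U).

Lemma decode_mem a X : limit a -> decode a X ∈ V a.
Proof.
intro La; unfold decode; destruct (excluded_middle_informative (X ∈ V a)); auto.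
now apply V_empty.
Qed.

Definition slots (r : U -> nat -> nat) a (s2 : nat -> U) : nat -> U :=
  fun n => slice a n (s2 (r (decode a (s2 0)) n)).

(* The second-order variables [0], ..., [m] of [q] hold the code of an index
   [i] and codes of sequences of sets; the variable [n] of [f i] is read off
   from the variable [r i n] of [q]. *)
Definition selects (r : U -> nat -> nat) (m : nat) (f : U -> formula U)
    (q : formula U) : Prop :=
  (forall n, ~ fv1 q n) /\ (forall n, fv2 q n -> n <= m) /\
  large k (fun a => forall s2, (forall n, s2 n ⊆ V a) ->
    sat a noval s2 (restr b k a q) <->
    sat a noval (slots r a s2) (restr b k a (f (decode a (s2 0))))).

(** From left to right some truth predicate must exist to be substituted; agreement of all truth
    predicates on nodes gives the rest. *)
Lemma selects_first_order (r : U -> nat -> nat) m (p : U -> fo U) :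
  (forall i, i ∈ V k -> fo_over k (p i)) -> (forall i n, r i n <= m) ->
  exists q, fo_over k q /\
    selects r m (fun i => FO (p i)) (All2 (S m) (FO q)).
Proof.
intros Hp Hr; assert (Lk := regular_limit Rk).
exists (truth_fo (Cneg p k) (Cpos p k) (Cdual p k) (Croot k) (Catom p r k) m).
split; [|split; [|split]].
- apply truth_fo_over; auto; intros; intros w Hw;
    unfold Cneg, Cpos, Cdual, Croot, Catom in Hw; rewrite mem_sep in Hw; tauto.
- intro n; apply truth_fo_fv1.
- intros n [H1 H2]; apply truth_fo_fv2 in H2; lia.
- assert (H : large k (fun a => forall i, i ∈ V a ->
    forall c, fo_par1 (p i) c -> c ∈ V a)).
  { apply (large_diag Hkp Rk (P := fun i a => forall c, fo_par1 (p i) c -> c ∈ V a)).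
    intros i Hi; apply large_fo_par1; auto; now apply Hp. }
  refine (large_mono _ H); intros a Ha Ra Ha' s2 Hs; cbn [restr sat].
  assert (La := regular_limit Ra); assert (Hka := upto_V Hkp Ha).
  set (i := decode a (s2 0)).
  assert (Hi : i ∈ V a) by now apply decode_mem.
  change (fo_sat a noval (slots r a s2) (fo_restr a (p i)))
    with (truth p r a s2 i nil).
  rewrite restr_truth_fo.
  assert (E : forall T, T ⊆ V a -> (fo_sat a noval (upd s2 (S m) T) (truth_fo
    (inter (Cneg p k) (V a)) (inter (Cpos p k) (V a)) (inter (Cdual p k) (V a))
    (inter (Croot k) (V a)) (fun j => inter (Catom p r k j) (V a)) m) <->
    (tarski p r k a s2 m T -> node i nil ∈ T))).
  { intros T HT; unfold truth_fo; cbn [fo_sat].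
    rewrite sat_tarski_fo by exact La.
    rewrite sat_root_fo by (exact La || exact (Hs 0)); cbn [eval2].
    rewrite upd_same.
    assert (E1 : (exists e, e ∈ V a /\
      op (decode a (upd s2 (S m) T 0)) e ∈ inter (Croot k) (V a) /\ e ∈ T) <->
      node i nil ∈ T).
    { change (upd s2 (S m) T 0) with (s2 0); fold i; split.
      - intros [e [_ [H1 H2]]]; apply mem_inter in H1; destruct H1 as [H1 _].
        unfold Croot in H1; rewrite mem_sep in H1; destruct H1 as [_ [j E1]].
        apply op_inj in E1; destruct E1 as [<- ->]; auto.
      - intro H1; exists (node i nil); assert (H2 := HT _ H1); split; auto.
        split; auto; apply mem_inter; split; [|now apply V_op].
        unfold Croot; rewrite mem_sep; split; [apply Hka; now apply V_op|eauto]. }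
    rewrite E1; unfold tarski.
    assert (E2 : forall d, edge a (upd s2 (S m) T) T (inter (Cneg p k) (V a))
      (inter (Cpos p k) (V a)) (fun j => inter (Catom p r k j) (V a)) m d <->
      edge a s2 T (inter (Cneg p k) (V a))
      (inter (Cpos p k) (V a)) (fun j => inter (Catom p r k j) (V a)) m d).
    { intro d; unfold edge.
      split; intros [e [He H1]]; exists e; split; auto;
        destruct H1 as [H1|[H1|[j [Hj H1]]]]; auto; right; right; exists j;
        rewrite upd_other in * by lia; auto. }
    split; intros H1 H2; apply H1; intros d Hd; specialize (H2 d Hd);
      rewrite E2 in *; auto. }
  split.
  + intro H1; destruct (tarski_exists s2 La Hka Ha' Hr) as [T [HT HT']].
    apply (tarski_truth La Hka Ha' Hr HT' Hi); [now intros c []|].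
    apply E; auto.
  + intros H1 T HT; apply E; auto; intro HT'.
    apply (tarski_truth La Hka Ha' Hr HT' Hi); [now intros c []|auto].
Qed.
End Selection.

(** * Selecting and combining formulas *)

Section Selection.
Context {U : zfc} (b : U -> U -> U -> U) (k kp : U)
  (Hb : canonical_bijections b) (Hkp : card_succ k kp) (Rk : regular k).
Implicit Types (x y z w a c i : U).

(** All [r] and [m] are allowed because passing a block of quantifiers changes both. *)
Definition selectable (s : bool) x : Prop :=
  forall (r : U -> nat -> nat) m (f : U -> formula U),
    (forall i, i ∈ V k -> lev k s x (f i)) -> (forall i n, r i n <= m) ->
    exists q, lev k s x q /\ selects b k r m f q.

Lemma selects_ext r m f g q : (forall i, i ∈ V k -> f i = g i) ->
  selects b k r m f q -> selects b k r m g q.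
Proof.
intros E [H1 [H2 H3]]; split; [|split]; auto.
refine (large_mono _ H3); intros a Ha Ra H s2 Hs; rewrite <- E; auto.
apply (upto_V Hkp Ha), decode_mem; now apply regular_limit.
Qed.

Lemma selectable_neg s x : selectable s x -> selectable (negb s) x.
Proof.
intros H r m f Hf Hr; destruct (H r m (fun i => neg (f i))) as [q [H1 [H2 [H3 H4]]]].
- intros i Hi; replace s with (negb (negb s)) by now destruct s.
  now apply lev_neg, Hf.
- auto.
- exists (neg q); split; [now apply lev_neg|split; [|split]].
  + intros n Hn; rewrite fv1_neg in Hn; exact (H2 n Hn).
  + intros n Hn; rewrite fv2_neg in Hn; auto.
  + refine (large_mono _ H4); intros a Ha Ra H' s2 Hs.
    rewrite restr_neg, sat_neg, (H' s2 Hs), restr_neg, sat_neg; split; [|tauto].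
    apply NNPP.
Qed.

(** The block of [f i] depends on [i], even in its length. One quantifier over codes of sequences
    replaces all these blocks, and the variables of the block are redirected to the new variable
    [S m]. *)
Lemma selects_quant (r : U -> nat -> nat) m (ns : U -> list nat) f q :
  (forall i n, r i n <= m) ->
  selects b k (fun i n => if in_dec Nat.eq_dec n (ns i) then S m else r i n) (S m) f q ->
  selects b k r m (fun i => fold_right (quant true) (f i) (ns i)) (All2 (S m) q).
Proof.
intros Hr [H1 [H2 H3]]; split; [|split]; auto.
- intros n [Hn1 Hn2]; apply H2 in Hn2; lia.
- refine (large_mono _ H3); intros a Ha Ra H s2 Hs; cbn [restr sat].
  assert (La := regular_limit Ra); rewrite restr_fold; unfold quant.
  set (i := decode a (s2 0)); rewrite sat_fold_All2.
  assert (HX : forall X, X ⊆ V a -> (sat a noval (upd s2 (S m) X) (restr b k a q) <->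
    sat a noval (fun n => slice a n (upd s2 (S m) X
       (if in_dec Nat.eq_dec n (ns i) then S m else r i n))) (restr b k a (f i)))).
  { intros X HX; apply (H (upd s2 (S m) X)); intro n; unfold upd.
    destruct (Nat.eqb n (S m)); auto. }
  split.
  + intros H' t Ht Ht'.
    set (X := sep (V a) (fun w => exists n v,
      In n (ns i) /\ v ∈ t n /\ w = op (num n) v)).
    assert (HXa : X ⊆ V a) by (intros w Hw; now apply mem_sep in Hw).
    specialize (H' X HXa); apply (HX X HXa) in H'.
    refine (eq_ind _ (fun s => sat a noval s _) H' _ _).
    apply functional_extensionality; intro n.
    destruct (in_dec Nat.eq_dec n (ns i)) as [Hn|Hn].
    * rewrite upd_same; apply mem_ext; intro v; unfold slice, X.
      rewrite !mem_sep; split.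
      -- intros [_ [_ [n' [v' [_ [Hv E]]]]]]; apply op_inj in E.
         destruct E as [E ->]; apply num_inj in E; now subst.
      -- intro Hv; assert (Hva := Ht n Hn v Hv); split; auto; split; eauto.
         apply V_op; auto; now apply V_num.
    * rewrite upd_other by (specialize (Hr i n); lia); now rewrite Ht'.
  + intros H' X HXa; apply HX; auto; apply H'.
    * intros n _ v Hv; unfold slice in Hv; rewrite mem_sep in Hv; tauto.
    * intros n Hn; destruct (in_dec Nat.eq_dec n (ns i)); [contradiction|].
      rewrite upd_other by (specialize (Hr i n); lia); reflexivity.
Qed.

Lemma slot_bound (r : U -> nat -> nat) m (ns : U -> list nat) :
  (forall i n, r i n <= m) -> forall i n,
  (if in_dec Nat.eq_dec n (ns i) then S m else r i n) <= S m.
Proof.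
intros Hr i n; specialize (Hr i n); destruct (in_dec Nat.eq_dec n (ns i)); lia.
Qed.

Lemma blocks x f : (forall i, i ∈ V k -> lev k true (succ x) (f i)) ->
  exists ns q, forall i, i ∈ V k ->
    f i = fold_right (quant true) (q i) (ns i) /\ lev k false x (q i).
Proof.
intro H; assert (H' : forall i, i ∈ V k -> exists d : list nat * formula U,
  f i = fold_right (quant true) (snd d) (fst d) /\ lev k false x (snd d)).
{ intros i Hi; apply H, lev_succ_inv in Hi; destruct Hi as [ns [q Hq]].
  now exists (ns, q). }
apply mem_choice in H'; [|exact (inhabits (nil, FO (Bot U)))].
destruct H' as [g Hg]; exists (fun i => fst (g i)), (fun i => snd (g i)); auto.
Qed.

Lemma selectable_succ x : selectable false x -> selectable true (succ x).
Proof.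
intros H r m f Hf Hr; destruct (blocks Hf) as [ns [g Hg]].
destruct (H _ _ g (fun i Hi => proj2 (Hg i Hi)) (slot_bound ns Hr)) as [q [H1 H2]].
exists (All2 (S m) q); split.
- exact (lev_succ (s := true) (S m :: nil) H1).
- apply selects_ext with (2 := selects_quant Hr H2).
  intros i Hi; symmetry; now apply Hg.
Qed.

Lemma selectable_one : selectable true (succ empty).
Proof.
intros r m f Hf Hr; destruct (blocks Hf) as [ns [g Hg]].
assert (Hp : forall i, i ∈ V k -> exists p, g i = FO p /\ fo_over k p).
{ intros i Hi; exact (lev_zero_inv (proj2 (Hg i Hi))). }
apply mem_choice in Hp; [|exact (inhabits (Bot U))]; destruct Hp as [p Hp].
destruct (selects_first_order b Hkp Rk (p := p) (fun i Hi => proj2 (Hp i Hi))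
  (slot_bound ns Hr)) as [q [H1 H2]].
(* [S m] codes the block of [f i] and [S (S m)] is the truth predicate. Both quantifiers are
   universal and form one block, so the level stays one. *)
exists (All2 (S m) (All2 (S (S m)) (FO q))); split.
- exact (lev_succ (s := true) (S m :: S (S m) :: nil) (lev_zero false H1)).
- apply selects_ext with (2 := selects_quant Hr H2).
  intros i Hi; destruct (Hg i Hi) as [-> _], (Hp i Hi) as [-> _]; reflexivity.
Qed.

(* Blocks of quantifiers may be empty, so that the finite levels increase; the
   infinite ones do not. *)
Lemma lev_num_S n s p : lev k s (num n) p -> lev k s (num (S n)) p.
Proof.
revert s p; induction n as [|n IH]; intros s p H.
- apply lev_zero_inv in H; destruct H as [q [-> Hq]].
  exact (lev_succ nil (lev_zero (negb s) Hq)).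
- apply lev_succ_inv in H; destruct H as [ns [q [-> Hq]]].
  apply lev_succ; now apply IH.
Qed.

Lemma limit_levels x f : limit x -> (forall i, i ∈ V k -> lev k true x (f i)) ->
  exists g : U -> U -> formula U, forall i, i ∈ V k ->
    f i = Conj x (g i) /\ forall z, z ∈ x -> lev k true z (g i z).
Proof.
intros Lx H; apply (mem_choice (R := fun i g =>
  f i = Conj x g /\ forall z, z ∈ x -> lev k true z (g z))).
- exact (inhabits (fun _ => FO (Bot U))).
- intros i Hi; destruct (lev_limit_inv Lx (H i Hi)) as [g [E [Hg _]]]; eauto.
Qed.

(* No first-order formula of second-order arguments selects among first-order
   formulas, so each finite level is treated at the next one. *)
Lemma selectable_limit x : x ∈ kp -> limit x ->
  (forall z, z ∈ x -> z <> empty -> selectable true z) -> selectable true x.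
Proof.
intros Hx Lx IH r m f Hf Hr; destruct (limit_levels Lx Hf) as [g Hg].
(* Here [y] is the index of the conjunct treated at [z]: [z] itself if [z] is infinite, the
   predecessor if [z] is finite and positive, and none if [z] is [empty]. *)
assert (Hsel : forall z, z ∈ x -> exists q, lev k true z q /\
  (forall n, ~ fv1 q n) /\ (forall n, fv2 q n -> n <= m) /\ large k (fun a =>
    forall s2, (forall n, s2 n ⊆ V a) -> sat a noval s2 (restr b k a q) <->
      forall y, (z ∉ omega /\ y = z \/ exists n, z = num (S n) /\ y = num n) ->
      sat a noval (slots r a s2) (restr b k a (g (decode a (s2 0)) y)))).
{ intros z Hz; destruct (classic (z ∈ omega)) as [Hw|Hw].
  - assert (Hw' := Hw); apply mem_omega_num in Hw'; destruct Hw' as [[|n] E].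
    + exists (FO (fo_not (Bot U))); subst; split; [|split; [|split]];
        try (simpl; tauto).
      * apply (lev_zero true); split; simpl; tauto.
      * apply large_intro; intros a _ _ s2 _; split; [|simpl; tauto].
        intros _ y [[H _]|H].
        -- contradiction.
        -- destruct H as [n [H _]]; symmetry in H; now apply succ_neq_empty in H.
    + destruct (IH z Hz) with (r := r) (m := m) (f := fun i => g i (num n))
        as [q [H1 [H2 [H3 H4]]]]; auto.
      * subst; apply succ_neq_empty.
      * intros i Hi; rewrite E; apply lev_num_S, (Hg i Hi).
        apply (ordinal_trans (proj1 Lx) (y := z)); auto; rewrite E; apply mem_succ_self.
      * exists q; split; [|split; [|split]]; auto; refine (large_mono _ H4).
        intros a Ha Ra H s2 Hs; rewrite (H s2 Hs); split.
        -- intros H' y [[Hz' _]|[n' [E' ->]]]; [contradiction|].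
           rewrite E in E'; apply num_inj in E'; now injection E' as <-.
        -- intro H'; apply H'; right; eauto.
  - destruct (IH z Hz) with (r := r) (m := m) (f := fun i => g i z)
      as [q [H1 [H2 [H3 H4]]]]; auto.
    + intros ->; apply Hw, mem_omega_num; now exists 0.
    + intros i Hi; now apply (Hg i Hi).
    + exists q; split; [|split; [|split]]; auto; refine (large_mono _ H4).
      intros a Ha Ra H s2 Hs; rewrite (H s2 Hs); split.
      * intros H' y [[_ ->]|[n [E _]]]; auto.
        destruct Hw; apply mem_omega_num; eauto.
      * intro H'; apply H'; auto. }
apply mem_choice in Hsel; [|exact (inhabits (FO (Bot U)))]; destruct Hsel as [q Hq].
destruct (merge_parameters Hb Hkp Rk Hx (s := true) (f := q)) as [K [h Hh]].
{ intros z Hz; now apply Hq. }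
exists (Conj x h); split; [|split; [|split]].
- apply (lev_limit (s := true)); auto.
  + intros z Hz; now apply Hh.
  + refine (finitely_many_sub _ (finitely_many_le m)).
    intros n [z [Hz H]]; apply (Hh z Hz) in H; now apply (Hq z Hz) in H.
  + exists (K :: nil); intros A [z [Hz H]]; left; symmetry; now apply (Hh z Hz) in H.
- intros n [z [Hz H]]; apply (Hh z Hz) in H; now apply (Hq z Hz) in H.
- intros n [z [Hz H]]; apply (Hh z Hz) in H; now apply (Hq z Hz) in H.
- assert (L1 := large_canF_diag Hb Hkp Rk Hx
    (fun z Hz => proj2 (proj2 (proj2 (proj2 (Hh z Hz)))))).
  assert (L2 := large_canF_diag Hb Hkp Rk Hx
    (fun z Hz => proj2 (proj2 (proj2 (Hq z Hz))))).
  (* The shift of finite indices by one must stay inside [canF b k x a]: [L3] serves the passage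
     from the selecting formula to [f i], and [L4] the converse. *)
  assert (L3 : large k (fun a => forall z, z ∈ canF b k x a ->
    succ z ∈ canF b k x a)).
  { apply (large_canF_diag Hb Hkp Rk Hx (P := fun z a => succ z ∈ canF b k x a)).
    intros z Hz; apply (large_canF_mem Hb Hkp Rk); auto; now apply Lx. }
  assert (L4 : large k (fun a => forall z, z ∈ canF b k x a ->
    forall n, z = num (S n) -> num n ∈ canF b k x a)).
  { apply (large_canF_diag Hb Hkp Rk Hx (P := fun z a =>
      forall n, z = num (S n) -> num n ∈ canF b k x a)).
    intros z Hz; destruct (classic (exists n, z = num (S n))) as [[n E]|E].
    - refine (large_mono _ (large_canF_mem Hb Hkp Rk Hx (z := num n) _)).
      + intros a Ha Ra H n' E'; rewrite E in E'; apply num_inj in E'.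
        now injection E' as <-.
      + apply (ordinal_trans (proj1 Lx) (y := z)); auto; rewrite E; apply mem_succ_self.
    - apply large_intro; intros a _ _ n E'; destruct E; eauto. }
  refine (large_mono _ (large_and Rk L1 (large_and Rk L2 (large_and Rk L3 L4)))).
  clear L1 L2 L3 L4; intros a Ha Ra [L1 [L2 [L3 L4]]] s2 Hs.
  assert (Hi : decode a (s2 0) ∈ V k).
  { apply (upto_V Hkp Ha), decode_mem; now apply regular_limit. }
  destruct (Hg _ Hi) as [-> _].
  rewrite !(sat_restr_Conj Hb Hkp Rk) by auto; split.
  + intros H z Hz; destruct (classic (z ∈ omega)) as [Hw|Hw].
    * apply mem_omega_num in Hw; destruct Hw as [n ->].
      assert (Hz' := L3 _ Hz); specialize (H _ Hz'); apply (L1 _ Hz') in H.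
      rewrite (L2 _ Hz' s2 Hs) in H; apply H; right; exists n; auto.
    * specialize (H _ Hz); apply (L1 _ Hz) in H.
      rewrite (L2 _ Hz s2 Hs) in H; apply H; auto.
  + intros H z Hz; apply (L1 _ Hz), (L2 _ Hz s2 Hs); intros y [[_ ->]|[n [E ->]]].
    * now apply H.
    * apply H; exact (L4 z Hz n E).
Qed.

Lemma selectable_all x s : x ∈ kp -> x <> empty -> selectable s x.
Proof.
intros Hx Nx; enough (H : selectable true x).
{ destruct s; auto; exact (selectable_neg H). }
clear s; revert Hx Nx; induction x as [x IH] using (well_founded_ind (@mem_wf U)).
intros Hx Nx; destruct (ordinal_cases (ordinal_below Hkp Hx)) as [E|[[y [_ E]]|Lx]].
- contradiction.
- subst; destruct (classic (y = empty)) as [->|Ny]; [apply selectable_one|].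
  apply selectable_succ; apply (selectable_neg (s := true)).
  assert (Hy := mem_succ_self y); apply IH; auto; exact (below_trans Hkp Hx Hy).
- apply selectable_limit; auto; intros z Hz; apply IH; auto.
  exact (below_trans Hkp Hx Hz).
Qed.

(** * Combining families of true sentences *)

Lemma fo_sat_ext a s1 s2 t2 p : (forall n, fo_fv2 p n -> s2 n = t2 n) ->
  fo_sat a s1 s2 p <-> fo_sat a s1 t2 p.
Proof.
revert s1; induction p as [t u|t u|t [n|A]| |p IHp q IHq|n p IHp]; simpl;
  intros s1 H; try reflexivity.
- now rewrite H.
- rewrite IHp, IHq; auto; reflexivity.
- split; intros H' c Hc; apply IHp; auto.
Qed.

Lemma sat_ext a s1 s2 t2 p : (forall n, fv2 p n -> s2 n = t2 n) ->
  sat a s1 s2 p <-> sat a s1 t2 p.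
Proof.
revert s2 t2; induction p as [p|n p IH|n p IH|x p IH|x p IH]; simpl; intros s2 t2 H.
- now apply fo_sat_ext.
- assert (E : forall X m, fv2 p m -> upd s2 n X m = upd t2 n X m).
  { intros X m Hm; unfold upd; destruct (Nat.eqb_spec m n); auto. }
  split; intros H' X HX; [rewrite <- (IH _ _ (E X))|rewrite (IH _ _ (E X))]; auto.
- assert (E : forall X m, fv2 p m -> upd s2 n X m = upd t2 n X m).
  { intros X m Hm; unfold upd; destruct (Nat.eqb_spec m n); auto. }
  split; intros [X [HX H']]; exists X; split; auto;
    [rewrite <- (IH _ _ (E X))|rewrite (IH _ _ (E X))]; auto.
- assert (E : forall z, z ∈ x -> (sat a s1 s2 (p z) <-> sat a s1 t2 (p z))).
  { intros z Hz; apply IH; eauto. }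
  split; intros H' z Hz; apply E; auto.
- assert (E : forall z, z ∈ x -> (sat a s1 s2 (p z) <-> sat a s1 t2 (p z))).
  { intros z Hz; apply IH; eauto. }
  split; intros [z [Hz H']]; exists z; split; auto; now apply E.
Qed.

(** The Tarski-Vaught argument without Skolem functions: a false universal formula has a
    counterexample, which lies in [V a] for large [a], and [large_diag] treats all values in [V a]
    simultaneously. *)
Lemma large_elementary s1 s2 p : (forall n, s1 n ∈ V k) -> fo_over k p ->
  large k (fun a => fo_sat k s1 s2 p <-> fo_sat a s1 s2 (fo_restr a p)).
Proof.
intros Hs [Hp _]; revert s1 Hs Hp.
induction p as [t u|t u|t [n|A]| |p IHp q IHq|n p IHp]; simpl; intros s1 Hs Hp;
  try (apply large_intro; reflexivity).
- assert (Ht : eval1 s1 t ∈ V k) by (destruct t; simpl in *; auto).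
  refine (large_mono _ (large_mem Ht)); intros a _ _ H; rewrite mem_inter; tauto.
- refine (large_mono _ (large_and Rk (IHp s1 Hs _) (IHq s1 Hs _))); auto.
  intros a _ _ [H1 H2]; tauto.
- assert (IH : large k (fun a => forall c, c ∈ V a -> (fo_sat k (upd s1 n c) s2 p <->
    fo_sat a (upd s1 n c) s2 (fo_restr a p)))).
  { apply (large_diag Hkp Rk (P := fun c a => fo_sat k (upd s1 n c) s2 p <->
      fo_sat a (upd s1 n c) s2 (fo_restr a p))).
    intros c Hc; apply IHp; auto; intro m; unfold upd; destruct (Nat.eqb m n); auto. }
  destruct (classic (exists c, c ∈ V k /\ ~ fo_sat k (upd s1 n c) s2 p))
    as [[c [Hc H]]|H].
  + refine (large_mono _ (large_and Rk IH (large_mem Hc))).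
    intros a Ha _ [H1 H2]; split; intro H'; [destruct (H (H' c Hc))|].
    destruct H; apply H1; auto.
  + refine (large_mono _ IH); intros a Ha _ H1.
    assert (H2 : forall c, c ∈ V k -> fo_sat k (upd s1 n c) s2 p).
    { intros c Hc; apply NNPP; intro H2; eauto. }
    split; auto; intros _ c Hc; apply H1; auto; apply H2; exact (upto_V Hkp Ha Hc).
Qed.

Definition combinable x : Prop := forall f : U -> formula U,
  (forall i, i ∈ V k -> lev k true x (f i) /\ sentence (f i) /\ models k (f i)) ->
  exists q, lev k true x q /\ sentence q /\ models k q /\
    large k (fun a => models a (restr b k a q) ->
      forall i, i ∈ V a -> models a (restr b k a (f i))).

Lemma combinable_zero : combinable empty.
Proof.
intros f Hf; exists (FO (fo_not (Bot U))); split; [|split; [|split]].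
- apply lev_zero; split; simpl; tauto.
- split; simpl; tauto.
- intro H; exact H.
- refine (large_mono _ (large_diag Hkp Rk (P := fun i a =>
    models a (restr b k a (f i))) _)); auto.
  intros i Hi; destruct (Hf i Hi) as [H1 [_ H2]]; apply lev_zero_inv in H1.
  destruct H1 as [p [E Hp]]; rewrite E in *.
  refine (large_mono _ (large_elementary (s1 := noval) noval _ Hp)).
  + intros a _ _ H; now apply H.
  + intro n; now apply V_empty, regular_limit.
Qed.

Lemma combinable_succ x : succ x ∈ kp -> combinable (succ x).
Proof.
intros Hx f Hf.
(* Variable [0] holds the index. As the [f i] are sentences, it can also be the source assigned to
   all their variables. *)
destruct (selectable_all (s := true) Hx (succ_neq_empty (x := x)) (r := fun _ _ => 0)
  (m := 0) (fun i Hi => proj1 (Hf i Hi))) as [q [Hq [F1 [F2 Lq]]]]; auto.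
assert (Hq' : lev k true (succ x) (All2 0 q)).
{ apply lev_succ_inv in Hq; destruct Hq as [ns [p [-> Hp]]].
  exact (lev_succ (s := true) (0 :: ns) Hp). }
assert (Hv : forall a X, X ⊆ V a -> forall n, upd noval 0 X n ⊆ V a).
{ intros a X HX n; unfold upd; destruct (Nat.eqb n 0); auto.
  intros v Hv; now apply mem_empty in Hv. }
exists (All2 0 q); split; [|split; [|split]]; auto.
- split; auto; intros n [H1 H2]; apply F2 in H2; lia.
(* Every subset of [V k] decodes to some index in [V k], so the quantifier over sets asks only for
   the truth of members of the family. *)
- apply (sat_restr_k Hb Hkp Rk noval noval Hx Hq'); intros X HX.
  apply (large_k Rk Lq); auto.
  change (upd noval 0 X 0) with X.
  assert (Hi : decode k X ∈ V k) by (apply decode_mem; now apply regular_limit).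
  destruct (Hf _ Hi) as [H1 [[_ H2] H3]].
  apply (sat_restr_k Hb Hkp Rk _ _ Hx H1).
  refine (proj1 (sat_ext _ _ _) H3); intros n Hn; destruct (H2 n Hn).
- assert (LR : large k (fun a => forall i, i ∈ V a -> forall n,
    ~ fv2 (restr b k a (f i)) n)).
  { apply (large_diag Hkp Rk (P := fun i a => forall n, ~ fv2 (restr b k a (f i)) n)).
    intros i Hi; destruct (Hf i Hi) as [H1 [[_ H2] _]].
    refine (large_mono _ (large_restr Hb Hkp Rk Hx H1)).
    intros a _ _ [_ [_ [H _]]] n Hn; exact (H2 n (H n Hn)). }
  refine (large_mono _ (large_and Rk Lq LR)); clear Lq LR.
  intros a Ha Ra [Lq LR] H i Hi.
  (* An index in [V a] is an admissible value of the variable [0] and decodes to itself. *)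
  assert (Hia : i ⊆ V a) by (apply V_subset; auto; now apply regular_limit).
  specialize (H i Hia); apply (Lq _ (Hv a i Hia)) in H.
  change (upd noval 0 i 0) with i in H.
  assert (E : decode a i = i).
  { unfold decode; destruct (excluded_middle_informative (i ∈ V a)); tauto. }
  rewrite E in H; refine (proj1 (sat_ext _ _ _) H); intros n Hn; destruct (LR i Hi n Hn).
Qed.

(** For each [z] the conjuncts at [z] of all [f i] are combined into [q z]. The [q z] have unrelated
    second-order parameters, so these are merged before the [q z] are conjoined. *)
Lemma combinable_limit x : x ∈ kp -> limit x ->
  (forall z, z ∈ x -> combinable z) -> combinable x.
Proof.
intros Hx Lx IH f Hf.
destruct (limit_levels Lx (fun i Hi => proj1 (Hf i Hi))) as [g Hg].
assert (Hq : forall z, z ∈ x -> exists q, lev k true z q /\ sentence q /\ models k q /\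
  large k (fun a => models a (restr b k a q) ->
      forall i, i ∈ V a -> models a (restr b k a (g i z)))).
{ intros z Hz; apply (IH z Hz (fun i => g i z)); intros i Hi.
  destruct (Hf i Hi) as [_ [[S1 S2] M]], (Hg i Hi) as [E Hgi]; rewrite E in *.
  split; [auto|split; [split|]].
  - intros n Hn; apply (S1 n); simpl; eauto.
  - intros n Hn; apply (S2 n); simpl; eauto.
  - exact (M z Hz). }
apply mem_choice in Hq; [|exact (inhabits (FO (Bot U)))]; destruct Hq as [q Hq].
destruct (merge_parameters Hb Hkp Rk Hx (s := true) (f := q)) as [K [h Hh]].
{ intros z Hz; now apply Hq. }
assert (N1 : forall z, z ∈ x -> forall n, ~ fv1 (h z) n).
{ intros z Hz n H; apply (Hh z Hz) in H; now apply (Hq z Hz) in H. }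
assert (N2 : forall z, z ∈ x -> forall n, ~ fv2 (h z) n).
{ intros z Hz n H; apply (Hh z Hz) in H; now apply (Hq z Hz) in H. }
exists (Conj x h); split; [|split; [|split]].
- apply (lev_limit (s := true)); auto.
  + intros z Hz; now apply Hh.
  + exists nil; intros n [z [Hz H]]; now apply N2 in H.
  + exists (K :: nil); intros A [z [Hz H]]; left; symmetry; now apply (Hh z Hz) in H.
- split; intros n [z [Hz H]]; [now apply N1 in H|now apply N2 in H].
- intros z Hz; destruct (Hh z Hz) as [H1 [_ [_ [_ H2]]]].
  assert (Hz' := below_trans Hkp Hx Hz).
  apply (sat_restr_k Hb Hkp Rk noval noval Hz' H1), (large_k Rk H2 noval).
  destruct (Hq z Hz) as [H3 [_ [H4 _]]].
  now apply (sat_restr_k Hb Hkp Rk noval noval Hz' H3).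
- assert (L1 := large_canF_diag Hb Hkp Rk Hx
    (fun z Hz => proj2 (proj2 (proj2 (proj2 (Hh z Hz)))))).
  assert (L2 := large_canF_diag Hb Hkp Rk Hx
    (fun z Hz => proj2 (proj2 (proj2 (Hq z Hz))))).
  refine (large_mono _ (large_and Rk L1 L2)); clear L1 L2.
  intros a Ha Ra [L1 L2] H i Hi.
  destruct (Hg i (upto_V Hkp Ha Hi)) as [-> _].
  apply (sat_restr_Conj Hb Hkp Rk); auto; intros z Hz.
  apply (L2 z Hz); auto; apply (L1 z Hz).
  unfold models in H; rewrite (sat_restr_Conj Hb Hkp Rk) in H; auto.
Qed.

Lemma combinable_all x : x ∈ kp -> combinable x.
Proof.
induction x as [x IH] using (well_founded_ind (@mem_wf U)); intro Hx.
destruct (ordinal_cases (ordinal_below Hkp Hx)) as [->|[[y [_ ->]]|Lx]].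
- apply combinable_zero.
- now apply combinable_succ.
- apply combinable_limit; auto; intros z Hz; apply IH; auto.
  exact (below_trans Hkp Hx Hz).
Qed.

(** The combined sentence gives the truth of the restrictions; that they are defined and of the
    right level is a property of large [a]. One function [h] takes care of both. *)
Lemma indescribable_reflects_family xi S f : xi ∈ kp -> indescribable b k xi S ->
  (forall i, i ∈ V k -> is_Pi k xi (f i) /\ sentence (f i) /\ models k (f i)) ->
  exists a, a ∈ S /\ a ∈ k /\ regular a /\ forall i, i ∈ V a ->
    restr_defined b k a (f i) /\ formula_over a (restr b k a (f i)) /\
    models a (restr b k a (f i)).
Proof.
intros Hxi HS Hf; destruct (combinable_all Hxi Hf) as [q [H1 [H2 [H3 H4]]]].
assert (H5 := large_diag Hkp Rk
  (fun i Hi => large_restr Hb Hkp Rk (s := true) Hxi (proj1 (Hf i Hi)))).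
destruct (large_and Rk H4 H5) as [h [Hh H]].
destruct (indescribable_reflects_closed Hb Hkp Hxi HS H1 H2 H3 Hh)
  as [a [HaS [Hak [Ra [Ma Ca]]]]].
exists a; refine (conj HaS (conj Hak (conj Ra _))); intros i Hi.
destruct (H a (or_introl Hak) Ra Ca) as [H6 H7].
destruct (H7 i Hi) as [H8 [H9 _]]; split; [auto|split; auto].
exists (canf b k xi a); now left.
Qed.

End Selection.

(** * The ideal of sets that are not indescribable *)

Lemma not_indescribable (U : zfc) (b : U -> U -> U -> U) (k xi X : U) :
  ~ indescribable b k xi X ->
  exists p, (is_Pi k xi p /\ sentence p /\ models k p) /\
    forall a, a ∈ X -> a ∈ k -> regular a -> restr_defined b k a p ->
      formula_over a (restr b k a p) -> ~ models a (restr b k a p).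
Proof.
intro H; apply NNPP; intro H'; apply H; intros p H1 H2 H3.
apply NNPP; intro H4; apply H'; exists p; split; auto.
intros a H5 H6 H7 H8 H9 H10; apply H4; exists a; auto 7.
Qed.

Theorem theorem5p6 (U : zfc) (b : U -> U -> U -> U)
    (b_can : canonical_bijections b)
    (kappa kappa_plus xi : U)
    (kappa_card : cardinal kappa)
    (kappa_succ : card_succ kappa kappa_plus)
    (xi_lt : xi ∈ kappa_plus)
    (kappa_ind : indescribable b kappa xi kappa) :
  ideal kappa (indescribable_ideal b kappa xi) /\
  nontrivial_ideal kappa (indescribable_ideal b kappa xi) /\
  normal_ideal kappa (indescribable_ideal b kappa xi).
Proof.
assert (Rk := indescribable_regular b_can kappa_card kappa_succ xi_lt kappa_ind).
assert (mem_I : forall X, X ∈ indescribable_ideal b kappa xi <->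
  X ⊆ kappa /\ ~ indescribable b kappa xi X).
{ intro X; unfold indescribable_ideal; rewrite mem_sep, mem_power; reflexivity. }
split; [split; [|split; [|split]]|split].
- intros X HX; apply mem_I in HX; now apply mem_power.
- apply mem_I; split; [intros z Hz; now apply mem_empty in Hz|intro H].
  destruct (lev_true kappa true (ordinal_below kappa_succ xi_lt))
    as [p [H1 [H2 [H3 [_ H4]]]]].
  destruct (H p H1 (conj H2 H3) (H4 _ _ _)) as [a [Ha _]]; now apply mem_empty in Ha.
- intros X Y HX HY; apply mem_I in HX; destruct HX as [H1 H2]; apply mem_I.
  split; [intros z Hz; auto|]; intro H; apply H2; intros p Hp Sp Mp.
  destruct (H p Hp Sp Mp) as [a [Ha Ha']]; exists a; split; auto.
- intros X Y HX HY; apply mem_I in HX, HY; destruct HX as [X1 X2], HY as [Y1 Y2].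
  assert (mem_XY : forall z, z ∈ union2 X Y <-> z ∈ X \/ z ∈ Y).
  { intro z; unfold union2; rewrite mem_union; split.
    - intros [w [Hw Hz]]; apply mem_pair in Hw; destruct Hw as [->| ->]; auto.
    - intros [Hz|Hz]; [exists X|exists Y]; rewrite mem_pair; auto. }
  apply mem_I; split; [intros z Hz; apply mem_XY in Hz; destruct Hz; auto|intro H].
  apply not_indescribable in X2, Y2.
  destruct X2 as [p [P1 P2]], Y2 as [q [Q1 Q2]].
  (* A union is treated as a family with two members: [empty] and [num 1] belong to every [V a] with
     [a] regular, so one reflection point serves both [p] and [q]. *)
  set (f := fun i : U => if excluded_middle_informative (i = empty) then p else q).
  destruct (indescribable_reflects_family b_can kappa_succ Rk (f := f) xi_lt H)
    as [a [Ha [Hak [Ra Hf]]]].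
  { intros i _; unfold f; destruct (excluded_middle_informative (i = empty)); auto. }
  assert (La := regular_limit Ra); apply mem_XY in Ha; destruct Ha as [Ha|Ha].
  + specialize (Hf empty (V_empty La)); unfold f in Hf.
    destruct (excluded_middle_informative (empty = empty)) as [_|N]; [|now apply N].
    destruct Hf as [F1 [F2 F3]]; exact (P2 a Ha Hak Ra F1 F2 F3).
  + specialize (Hf (num 1) (V_num 1 La)); unfold f in Hf.
    destruct (excluded_middle_informative (num 1 = empty)) as [N|_].
    { now apply succ_neq_empty in N. }
    destruct Hf as [F1 [F2 F3]]; exact (Q2 a Ha Hak Ra F1 F2 F3).
- intro H; apply mem_I in H; tauto.
- intros S f HS HI Hf; assert (HS' : S ⊆ kappa) by (rewrite mem_power in HS; exact HS).
  assert (IS : indescribable b kappa xi S).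
  { apply NNPP; intro H; apply HI, mem_I; auto. }
  apply NNPP; intro H.
  assert (null : forall c, c ∈ V kappa ->
    ~ indescribable b kappa xi (sep S (fun a => f a = c))).
  { intros c _ Hc; apply H; exists (sep S (fun a => f a = c)); split; [|split].
    - intros z Hz; now apply mem_sep in Hz.
    - intro Hc'; apply mem_I in Hc'; tauto.
    - exists c; intros a Ha; now apply mem_sep in Ha. }
  (* The chosen [p c] refutes indescribability of the fibre of [f] over [c]. A point [a ∈ S]
     reflecting all [p i] with [i ∈ V a] reflects [p (f a)], although it lies in the fibre over
     [f a]. *)
  assert (wit := fun c Hc => not_indescribable (null c Hc)).
  apply mem_choice in wit; [|exact (inhabits (FO (Bot U)))]; destruct wit as [p Hp].
  destruct (indescribable_reflects_family b_can kappa_succ Rk (f := p) xi_lt IS)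
    as [a [Ha [Hak [Ra Hr]]]].
  { intros i Hi; apply (Hp i Hi). }
  assert (Hfa : f a ∈ V a) by (apply subset_V; auto).
  assert (Hfk : f a ∈ V kappa) by exact (upto_V kappa_succ (or_introl Hak) Hfa).
  destruct (Hr _ Hfa) as [F1 [F2 F3]].
  apply (proj2 (Hp _ Hfk) a); auto; apply mem_sep; auto.
Qed.
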